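(* Let $l,n\ge1$ and $e\ge2$ be integers and $\mathbf{s}=(s_1,\dots,s_l)\in\mathbb{Z}^l$. Let $\mathfrak{I}$ be the set of $i\in\{0,\dots,e-1\}$ such that $s_j\equiv i\pmod e$ for some $j\in\{1,\dots,l\}$, and for $k\in\mathfrak{I}$ let $\alpha(k)$ be the minimal element $c$ of $\{1,\dots,l\}$ such that $s_c\equiv k\pmod e$ and $s_c=\max\{s_j\mid 1\le j\le l,\ s_j\equiv k\pmod e\}$. Let $k_0,\dots,k_s$ be the elements of $\mathfrak{I}$, numbered so that $\alpha(k_0)<\alpha(k_1)<\dots<\alpha(k_s)$, and assume that $$s_{\alpha(k_0)}>s_{\alpha(k_1)}>\dots>s_{\alpha(k_s)}.$$ Then $$[1^n,\alpha(k_0)]_{\theta_{\mathbf{s}}}=\big[\big((q+1)^r,q^{e-1-r}\big),\alpha(k_0)\big],$$ where $(q,r)\in\mathbb{Z}_{\ge0}\times\{0,1,\dots,e-2\}$ is defined by the Euclidean division $n=q(e-1)+r$. If $i\in\{1,\dots,s\}$, let $j\in\{0,\dots,i-1\}$ be such that the integer $x\in\{1,\dots,e-1\}$ with $x\equiv k_i-k_j\pmod e$ is minimal. Then $$[1^n,\alpha(k_i)]_{\theta_{\mathbf{s}}}=\begin{cases}[1^n,\alpha(k_i)]&\text{if }n\le x,\\ [1^x,\alpha(k_i)]+[1^{n-x},\alpha(k_j)]_{\theta_{\mathbf{s}}}&\text{otherwise.}\end{cases}$$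
   Context: **Ariki-Koike algebra.** Let $A=\mathbb{C}[q^{\pm1},Q_1,\dots,Q_l]$ with $q,Q_1,\dots,Q_l$ indeterminates (this indeterminate $q$ is unrelated to the quotient $q$ of the claim), and $K=\mathrm{Frac}(A)$. $\mathcal{H}$ (for a given $n$) is the associative $A$-algebra generated by $T_0,\dots,T_{n-1}$ with relations $(T_0-Q_1)\cdots(T_0-Q_l)=0$, $(T_i-q)(T_i+1)=0$ ($1\le i\le n-1$), $(T_0T_1)^2=(T_1T_0)^2$, $T_iT_{i+1}T_i=T_{i+1}T_iT_{i+1}$ ($1\le i\le n-2$), $T_iT_j=T_jT_i$ ($j\ge i+2$). An $l$-partition $\boldsymbol{\lambda}=(\lambda^1,\dots,\lambda^l)\vdash_l n$ is an $l$-tuple of partitions of total size $n$ (partitions are extended by infinitely many zero parts). The algebra $K\mathcal{H}$ is split semisimple with simple modules $KV^{\boldsymbol{\lambda}}$, $\boldsymbol{\lambda}\vdash_l n$; $KV^{\boldsymbol{\lambda}}$ is characterized by having a basis indexed by standard $\boldsymbol{\lambda}$-tableaux $\mathfrak{t}$ on which, for $1\le i\le n$, $L_i=q^{1-i}T_{i-1}\cdots T_1T_0T_1\cdots T_{i-1}$ acts by the scalar $Q_cq^{b-a}$, where $(a,b,c)$ (row $a$, column $b$, component $c$) is the node containing $i$ in $\mathfrak{t}$. $V^{\boldsymbol{\lambda}}$ denotes an $\mathcal{H}$-module, free of finite rank over $A$, with $K\otimes_AV^{\boldsymbol{\lambda}}\simeq KV^{\boldsymbol{\lambda}}$. **One dimensional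 modules and notation.** For a partition $\nu$, $[\nu,j]$ is the $l$-partition with $j$-th component $\nu$ and all other components empty; exponents in partitions denote repeated parts (zero parts are dropped), so $[1^n,j]$ has $j$-th component $(1^n)$. $V^{[1^n,j]}$ is the one dimensional module $T_0\mapsto Q_j$, $T_i\mapsto-1$ ($i\ge1$). **Specialization.** Let $\eta\in\mathbb{C}$ be a primitive $e$-th root of $1$; $\theta_{\mathbf{s}}:A\to\mathbb{C}$ sends $q\mapsto\eta$, $Q_j\mapsto\eta^{s_j}$. $\mathbb{C}_{\theta_{\mathbf{s}}}\mathcal{H}$ and $\mathbb{C}_{\theta_{\mathbf{s}}}V^{\boldsymbol{\lambda}}$ are the specializations; $[\mathbb{C}_{\theta_{\mathbf{s}}}V^{\boldsymbol{\lambda}}:M]$ is the composition multiplicity of a simple module $M$ (independent of the choice of $V^{\boldsymbol{\lambda}}$). **Labels of simple modules.** Choose rationals $v_1<v_2<\dots<v_l<v_1+e$ and put $m_j=s_j-v_j$. For $\boldsymbol{\lambda}\vdash_l n$ let $\kappa_1(\boldsymbol{\lambda})\ge\kappa_2(\boldsymbol{\lambda})\ge\cdots$ be the elements of the multiset $\{\lambda^c_a-a+m_c\mid 1\le c\le l,\ a\ge1\}$ in weakly decreasing order. Write $\boldsymbol{\mu}\ll\boldsymbol{\lambda}$ if $\boldsymbol{\mu}=\boldsymbol{\lambda}$, or if $\kappa(\boldsymbol{\mu})\ne\kappa(\boldsymbol{\lambda})$ and $\sum_{i\le t}\kappa_i(\boldsymbol{\mu})\le\sum_{i\le t}\kappa_i(\boldsymbol{\lambda})$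 for all $t\ge1$. It is known that for each simple $\mathbb{C}_{\theta_{\mathbf{s}}}\mathcal{H}$-module $M$ there is a unique $\boldsymbol{\lambda}_M\vdash_l n$ with $[\mathbb{C}_{\theta_{\mathbf{s}}}V^{\boldsymbol{\lambda}_M}:M]=1$ and such that $[\mathbb{C}_{\theta_{\mathbf{s}}}V^{\boldsymbol{\mu}}:M]\ne0$ implies $\boldsymbol{\mu}\ll\boldsymbol{\lambda}_M$; moreover $M\mapsto\boldsymbol{\lambda}_M$ is injective and does not depend on the choice of the $v_j$. **Notation.** If $V^{\boldsymbol{\lambda}}$ is one dimensional, $\boldsymbol{\lambda}_{\theta_{\mathbf{s}}}:=\boldsymbol{\lambda}_M$ for the simple module $M=\mathbb{C}_{\theta_{\mathbf{s}}}V^{\boldsymbol{\lambda}}$ (for $[1^{n-x},\alpha(k_j)]_{\theta_{\mathbf{s}}}$ the algebra is the one for $n-x$ in place of $n$). The sum of two $l$-partitions is componentwise and partwise: $(\boldsymbol{\mu}+\boldsymbol{\nu})^c_a=\mu^c_a+\nu^c_a$. *)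

(* Defs.v *)
From HB Require Import structures.
From mathcomp Require Import all_boot all_order all_algebra.
From mathcomp Require Import mpoly complex.
From mathcomp Require Import boolp classical_sets reals.

Set Implicit Arguments.
Unset Strict Implicit.
Unset Printing Implicit Defensive.

Import Order.TTheory GRing.Theory Num.Theory.
Local Open Scope ring_scope.

(* F[q^±1, Q_1, ..., Q_l], realized as the subring of F(q, Q_1, ..., Q_l) of  *)
(* the fractions p / q^k; in {mpoly F[l.+1]}, 'X_ord0 is q and                *)
(* 'X_(lift ord0 j) is the parameter Q of index j.                            *)
Section Laurent.
Variables (l : nat) (F : fieldType).

Definition ratfun : fieldType := {fraction {mpoly F[l.+1]}}.

Definition ratfun_mpoly (p : {mpoly F[l.+1]}) : ratfun := tofrac p.

Definition is_laurent : {pred ratfun} := fun x =>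
  `[< exists (p : {mpoly F[l.+1]}) (k : nat),
        x = ratfun_mpoly p / ratfun_mpoly 'X_ord0 ^+ k >].

Lemma ratfun_q_neq0 : ratfun_mpoly 'X_ord0 != 0.
Proof.
rewrite tofrac_eq0; apply/eqP => /(congr1 (fun p => p@_U_(ord0))).
by rewrite mcoeffX eqxx mcoeff0 => /eqP; rewrite oner_eq0.
Qed.

Lemma is_laurent_subring : subring_closed is_laurent.
Proof.
have q0 k : ratfun_mpoly 'X_ord0 ^+ k != 0 by rewrite expf_neq0 ?ratfun_q_neq0.
split.
- by apply/asboolP; exists 1, 0%N; rewrite expr0 divr1 [RHS]tofrac1.
- move=> x y /asboolP [p [k ->]] /asboolP [r [m ->]]; apply/asboolP.
  exists (p * 'X_ord0 ^+ m - r * 'X_ord0 ^+ k), (k + m)%N.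
  rewrite /ratfun_mpoly tofracB !tofracM !tofracXn -!/(ratfun_mpoly _).
  by rewrite -mulNr addf_div // mulNr exprD.
- move=> x y /asboolP [p [k ->]] /asboolP [r [m ->]]; apply/asboolP.
  exists (p * r), (k + m)%N.
  by rewrite /ratfun_mpoly tofracM -!/(ratfun_mpoly _) mulf_div exprD.
Qed.

HB.instance Definition _ :=
  GRing.isSubringClosed.Build ratfun is_laurent is_laurent_subring.

Record laurent := Laurent { laurent_val :> ratfun; _ : is_laurent laurent_val }.

HB.instance Definition _ := [isSub for laurent_val].
HB.instance Definition _ := [Choice of laurent by <:].
HB.instance Definition _ := [SubChoice_isSubComNzRing of laurent by <:].

Lemma is_laurent_mpoly p : is_laurent (ratfun_mpoly p).
Proof. by apply/asboolP; exists p, 0%N; rewrite expr0 divr1. Qed.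

Definition laurent_mpoly p : laurent := Laurent (is_laurent_mpoly p).
Definition laurentC (c : F) : laurent := laurent_mpoly c%:MP.
Definition laurent_q : laurent := laurent_mpoly 'X_ord0.
Definition laurent_Q (j : 'I_l) : laurent := laurent_mpoly 'X_(lift ord0 j).

End Laurent.

(* theta restricts to the identity on F and sends q to eta, Q_j to eta ^ s_j. *)
(* These conditions determine theta uniquely.                                 *)
Definition is_specialization (F : fieldType) (l : nat) (eta : F)
    (s : 'I_l -> int) (theta : {rmorphism laurent l F -> F}) : Prop :=
  [/\ forall c : F, theta (laurentC l c) = c,
      theta (laurent_q l F) = eta
    & forall j : 'I_l, theta (laurent_Q F j) = eta ^ s j].

Section SpecializationExists.
Variables (F : fieldType) (l : nat) (eta : F) (s : 'I_l -> int).
Hypothesis eta0 : eta != 0.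

Let pt (i : 'I_l.+1) : F := if unlift ord0 i is Some j then eta ^ s j else eta.

Let value (x : laurent l F) (z : F) : Prop :=
  exists (p : {mpoly F[l.+1]}) (k : nat),
    val x = ratfun_mpoly p / ratfun_mpoly 'X_ord0 ^+ k /\
    z = p.@[pt] / eta ^+ k.

Let value_ex x : exists z, value x z.
Proof. by case: x => x xP; have /asboolP [p [k xE]] := xP; do 3!eexists; eauto. Qed.

Let value_uniq x z z' : value x z -> value x z' -> z = z'.
Proof.
have q0 k : ratfun_mpoly 'X_ord0 ^+ k != 0 :> ratfun l F.
  by rewrite expf_neq0 ?ratfun_q_neq0.
have e0 k : eta ^+ k != 0 by rewrite expf_neq0.
move=> [p [k [xE ->]]] [p' [k' [/eqP + ->]]].
rewrite xE eqr_div // /ratfun_mpoly -!tofracXn -!tofracM tofrac_eq => /eqP.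
move=> /(congr1 (meval pt)); rewrite !mevalM !rmorphXn /= !mevalXU.
by rewrite /pt unlift_none => E; apply/eqP; rewrite eqr_div // E.
Qed.

Lemma specialization_exists : exists theta, @is_specialization F l eta s theta.
Proof.
have q0 k : ratfun_mpoly 'X_ord0 ^+ k != 0 :> ratfun l F.
  by rewrite expf_neq0 ?ratfun_q_neq0.
have e0 k : eta ^+ k != 0 by rewrite expf_neq0.
pose th x := xget 0 (value x).
have thP x : value x (th x) by apply: xgetPex; exact: value_ex.
have thE x z : value x z -> th x = z by apply: value_uniq.
have thp p : th (laurent_mpoly p) = p.@[pt].
  by apply: thE; exists p, 0%N; rewrite !expr0 !divr1.
have thB : zmod_morphism th.
  move=> x y; apply: thE.
  have [p [k [xE ->]]] := thP x; have [r [m [yE ->]]] := thP y.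
  exists (p * 'X_ord0 ^+ m - r * 'X_ord0 ^+ k), (k + m)%N; split.
    rewrite rmorphB /= -[laurent_val x]/(val x) -[laurent_val y]/(val y) xE yE.
    rewrite /ratfun_mpoly tofracB !tofracM !tofracXn -!/(ratfun_mpoly _).
    by rewrite -mulNr addf_div // mulNr exprD.
  rewrite mevalB !mevalM !rmorphXn /= !mevalXU /pt unlift_none.
  by rewrite -mulNr addf_div // mulNr exprD.
have thM : monoid_morphism th.
  split.
    by apply: thE; exists 1, 0%N; rewrite !rmorph1 !expr0 !divr1 [RHS]tofrac1.
  move=> x y; apply: thE.
  have [p [k [xE ->]]] := thP x; have [r [m [yE ->]]] := thP y.
  exists (p * r), (k + m)%N; split.
    rewrite rmorphM /= -[laurent_val x]/(val x) -[laurent_val y]/(val y) xE yE.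
    by rewrite /ratfun_mpoly tofracM -!/(ratfun_mpoly _) mulf_div exprD.
  by rewrite mevalM mulf_div exprD.
pose ZM := GRing.isZmodMorphism.Build _ _ th thB.
pose MM := GRing.isMonoidMorphism.Build _ _ th thM.
pose theta : {rmorphism laurent l F -> F} := HB.pack th ZM MM.
exists theta; split => [c||j] /=.
- by rewrite thp mevalC.
- by rewrite thp mevalXU /pt unlift_none.
- by rewrite thp mevalXU /pt liftK.
Qed.
End SpecializationExists.

(* A module over the Ariki-Koike algebra with generators T_0, ..., T_(n-1)    *)
(* and parameters q, Q, free of rank AKdim over the base ring, with a chosen  *)
(* basis: matrices satisfying the defining relations. Matrices act on row     *)
(* vectors; since the set of relations and the elements L_i are invariant     *)
(* under reversing words, left and right modules need not be distinguished.   *)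
(* AKact i is meaningful only for i < n.                                      *)
Section Modules.
Variables (R : comNzRingType) (l : nat) (q : R) (Q : 'I_l -> R) (n : nat).

Definition AK_relations (d : nat) (T : nat -> 'M[R]_d) : Prop :=
  [/\ (0 < n)%N -> \prod_(j < l) (T 0%N - (Q j)%:M) = 0,
      forall i, (0 < i < n)%N -> (T i - q%:M) * (T i + 1) = 0,
      (1 < n)%N -> (T 0%N * T 1%N) ^+ 2 = (T 1%N * T 0%N) ^+ 2,
      forall i, (0 < i)%N -> (i.+1 < n)%N ->
        T i * T i.+1 * T i = T i.+1 * T i * T i.+1
    & forall i j, (i.+1 < j < n)%N -> T i * T j = T j * T i].

Record AKmodule := AKModule {
  AKdim : nat;
  AKact : nat -> 'M[R]_AKdim;
  AKactP : AK_relations AKact }.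

End Modules.

Section BaseChange.
Variables (R S : comNzRingType) (f : {rmorphism R -> S}).
Variables (l : nat) (q : R) (Q : 'I_l -> R) (n : nat).

Lemma map_mx_prod d (I : finType) (G : I -> 'M[R]_d) :
  map_mx f (\prod_i G i) = \prod_i map_mx f (G i).
Proof.
by elim/big_rec2: _ => [|i x y _ <-]; [exact: map_mx1 | exact: map_mxM].
Qed.

Lemma AK_relations_map d (T : nat -> 'M[R]_d) :
  AK_relations q Q n T ->
  AK_relations (f q) (f \o Q) n (fun i => map_mx f (T i)).
Proof.
have fM (A B : 'M[R]_d) : map_mx f (A * B) = map_mx f A * map_mx f B.
  exact: map_mxM.
have f1 : map_mx f (1 : 'M[R]_d) = 1 by exact: map_mx1.
case=> rel0 rel1 rel01 braid comm; split.
- move=> n0; rewrite -[RHS](map_mx0 f) -(rel0 n0) map_mx_prod.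
  by apply: eq_bigr => j _; rewrite map_mxB map_scalar_mx.
- move=> i /rel1 /(congr1 (map_mx f)).
  by rewrite fM map_mxB map_mxD f1 map_scalar_mx map_mx0.
- by move=> /rel01 /(congr1 (map_mx f)); rewrite !expr2 !fM.
- by move=> i i0 /(braid i i0) /(congr1 (map_mx f)); rewrite !fM.
- by move=> i j /comm /(congr1 (map_mx f)); rewrite !fM.
Qed.

Definition base_change (V : AKmodule q Q n) : AKmodule (f q) (f \o Q) n :=
  AKModule (AK_relations_map (AKactP V)).

End BaseChange.

Section CompositionMultiplicity.
Variables (F : fieldType) (l : nat) (q : F) (Q : 'I_l -> F) (n : nat).
Implicit Types V M : AKmodule q Q n.

Definition submodule V (U : 'M[F]_(AKdim V)) : Prop :=
  forall i, (i < n)%N -> stablemx U (AKact V i).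

Definition simple_module V : Prop :=
  (0 < AKdim V)%N /\
  forall U : 'M[F]_(AKdim V), submodule U -> U = 0 \/ row_full U.

Definition composition_series V (r : nat) (U : nat -> 'M[F]_(AKdim V)) : Prop :=
  [/\ U 0%N = 0, row_full (U r),
      forall i, (i <= r)%N -> submodule (U i)
    & forall i, (i < r)%N -> (U i < U i.+1)%MS /\
        forall W : 'M[F]_(AKdim V), submodule W ->
          (U i <= W)%MS -> (W <= U i.+1)%MS ->
          (W == U i)%MS \/ (W == U i.+1)%MS].

(* For submodules U1 <= U2 of V: the quotient U2 / U1 is isomorphic to M,     *)
(* i.e. some linear map, restricted to U2, is a surjective module morphism    *)
(* onto M with kernel U1.                                                     *)
Definition quotient_iso V (U1 U2 : 'M[F]_(AKdim V)) M : Prop :=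
  exists f : 'M[F]_(AKdim V, AKdim M),
    [/\ forall i, (i < n)%N -> U2 *m AKact V i *m f = U2 *m f *m AKact M i,
        row_full (U2 *m f)
      & forall u : 'rV[F]_(AKdim V), (u <= U2)%MS ->
          (u *m f == 0) = (u <= U1)%MS].

(* The multiplicity [V : M]; by Jordan-Hoelder all composition series give    *)
(* the same number.                                                           *)
Definition comp_mult V M : nat :=
  xget 0%N [set k | exists (r : nat) (U : nat -> 'M[F]_(AKdim V)),
    composition_series r U /\
    k = #|[pred i : 'I_r | `[< quotient_iso (U i) (U i.+1) M >]]|]%classic.

End CompositionMultiplicity.

Section Multipartitions.
Variable l : nat.

Definition is_part (p : seq nat) : bool := sorted geq p && (0%N \notin p).

Definition mpart : Type := {ffun 'I_l -> seq nat}.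

Definition is_mpart (n : nat) (lambda : mpart) : bool :=
  [forall c, is_part (lambda c)] && (\sum_c sumn (lambda c) == n)%N.

Definition mpart0 : mpart := [ffun=> [::]].

Definition single (p : seq nat) (j : 'I_l) : mpart :=
  [ffun c => if c == j then p else [::]].

Definition add_part (p r : seq nat) : seq nat :=
  mkseq (fun a => nth 0 p a + nth 0 r a)%N (maxn (size p) (size r)).

Definition add_mpart (mu nu : mpart) : mpart :=
  [ffun c => add_part (mu c) (nu c)].

(* Nodes (a, b, c): row a, column b, component c, with a and b numbered from  *)
(* 0, which leaves b - a unchanged.                                           *)
Definition node : Type := (nat * nat * 'I_l)%type.

Definition in_diagram (lambda : mpart) (x : node) : bool :=
  let: (a, b, c) := x in (b < nth 0 (lambda c) a)%N.

(* t k is the node containing the entry k + 1. *)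
Definition standard_tableau (n : nat) (lambda : mpart) (t : {ffun 'I_n -> node}) :
    Prop :=
  [/\ injective t,
      forall x, in_diagram lambda x <-> exists k, t k = x,
      forall k m a b b' c, t k = (a, b, c) -> t m = (a, b', c) ->
        (b < b')%N -> (k < m)%N
    & forall k m a a' b c, t k = (a, b, c) -> t m = (a', b, c) ->
        (a < a')%N -> (k < m)%N].

End Multipartitions.

Section GenericModules.
Variables (K : fieldType) (l : nat) (q : K) (Q : 'I_l -> K) (n : nat).
Implicit Type V : AKmodule q Q n.

(* jucys_murphy V k is the action of L_(k+1). *)
Fixpoint jucys_murphy V (k : nat) : 'M[K]_(AKdim V) :=
  if k is k'.+1 then q^-1 *: (AKact V k * jucys_murphy V k' * AKact V k)
  else AKact V 0%N.

Definition residue (x : node l) : K :=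
  let: (a, b, c) := x in Q c * q ^ (b%:Z - a%:Z).

(* The simple module KV^lambda. The rows of the invertible matrix P are the   *)
(* vectors of the basis, indexed by the standard tableaux through tab.        *)
Definition is_KV (lambda : mpart l) V : Prop :=
  simple_module V /\
  exists (P : 'M[K]_(AKdim V)) (tab : 'I_(AKdim V) -> {ffun 'I_n -> node l}),
    [/\ P \in unitmx,
        injective tab,
        forall t, standard_tableau lambda t <-> exists i, tab i = t
      & forall i (k : 'I_n),
          row i P *m jucys_murphy V k = residue (tab i k) *: row i P].

End GenericModules.

(* V is an A-form V^lambda of the simple module KV^lambda. *)
Definition is_form (F : fieldType) (l n : nat) (lambda : mpart l)
    (V : AKmodule (laurent_q l F) (@laurent_Q l F) n) : Prop :=
  is_KV lambda (base_change (val : {rmorphism laurent l F -> ratfun l F}) V).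

Section Labels.
Variables (l : nat) (s : 'I_l -> int) (v : 'I_l -> rat).

Definition charge (c : 'I_l) : rat := (s c)%:~R - v c.

(* kappa lambda i is kappa_(i+1)(lambda). As the numbers decrease strictly    *)
(* with a in each component, the i + 1 largest elements of the multiset all   *)
(* have a <= i + 1.                                                           *)
Definition kappa (lambda : mpart l) (i : nat) : rat :=
  nth 0 (sort (fun x y => y <= x)
    [seq (nth 0%N (lambda c) a.-1)%:R - a%:R + charge c
      | c <- enum 'I_l, a <- iota 1 i.+1]) i.

Definition ll_order (mu lambda : mpart l) : Prop :=
  mu = lambda \/
  ~ (kappa mu =1 kappa lambda) /\
  forall t, \sum_(i < t) kappa mu i <= \sum_(i < t) kappa lambda i.

Definition is_label (F : fieldType) (q : F) (Q : 'I_l -> F) (n : nat)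
    (D : mpart l -> AKmodule q Q n) (M : AKmodule q Q n) (lambda : mpart l) :
    Prop :=
  [/\ is_mpart n lambda, comp_mult (D lambda) M = 1%N
    & forall mu, is_mpart n mu -> comp_mult (D mu) M <> 0%N ->
        ll_order mu lambda].

(* The l-partition lambda_M. There is at most one. The default value mpart0   *)
(* is not an l-partition of n > 0, so it cannot be mistaken for a label.      *)
Definition label (F : fieldType) (q : F) (Q : 'I_l -> F) (n : nat)
    (D : mpart l -> AKmodule q Q n) (M : AKmodule q Q n) : mpart l :=
  xget (mpart0 l) (is_label D M).

(* lambda_theta, where V m mu is V^mu for mu an l-partition of m. *)
Definition theta_label (F : fieldType) (theta : {rmorphism laurent l F -> F})
    (V : forall m, mpart l -> AKmodule (laurent_q l F) (@laurent_Q l F) m)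
    (n : nat) (lambda : mpart l) : mpart l :=
  label (fun mu => base_change theta (V n mu)) (base_change theta (V n lambda)).

End Labels.

Section Residues.
Variables (l e : nat) (s : 'I_l -> int).

Definition residue_class (k : 'I_e) (c : 'I_l) : bool :=
  (s c == k%:Z %[mod e%:Z])%Z.

Definition residue_set : {set 'I_e} :=
  [set k | [exists c, residue_class k c]]%SET.

Definition is_max_in_class (k : 'I_e) (c : 'I_l) : bool :=
  residue_class k c && [forall c', residue_class k c' ==> (s c' <= s c)].

Definition is_alpha (k : 'I_e) (c : 'I_l) : bool :=
  is_max_in_class k c && [forall c', is_max_in_class k c' ==> (c <= c')%N].

End Residues.

(* Main.v *)
(* The weights of a module are the joint eigenvalues of the Jucys-Murphy      *)
(* elements L_1, ..., L_n. For the specialization of V^mu they are read off   *)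
(* from the residues of the standard mu-tableaux, and the one dimensional     *)
(* module M = V^[1^n, c] has the single weight                                *)
(* i = (s_c, s_c - 1, ..., s_c - n + 1). Adding nodes with these residues one *)
(* at a time, always in the position of largest charged content, gives a      *)
(* tableau of the l-partition lambda of the theorem, and its k-th node        *)
(* dominates the k-th node of any other tableau of weight i. Hence            *)
(* [V^mu : M] <> 0 forces mu << lambda.                                       *)
(*   Only one lambda-tableau has weight i, so exactly one composition factor  *)
(* N of V^lambda has this weight, and N = M because no lambda-tableau has     *)
(* weight (i_1, ..., i_m, i_m, ...): by descending induction on m, the vector *)
(* of weight i spans a module over the affine Hecke algebra on the strands    *)
(* m, ..., n, since in a simple module X a simple submodule K of the          *)
(* i_m-eigenspace of L_m generates X, and L_m has no eigenvalue i_m on X / K. *)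

Require Import Defs.
From mathcomp Require Import all_boot all_order all_algebra.
From mathcomp Require Import zify ring lra.
From mathcomp Require Import mpoly complex boolp classical_sets reals.

Set Implicit Arguments.
Unset Strict Implicit.
Unset Printing Implicit Defensive.

Import Order.TTheory GRing.Theory Num.Theory.
Local Open Scope ring_scope.

(** * Jucys-Murphy elements *)

(** Write M for the specialized module of [1^n, [a i]]. Its label is determined by two facts about
    the shape lambda of the greedy tableau: M occurs once in V^lambda, and mu << lambda whenever M
    occurs in V^mu. Two l-partitions with both properties are comparable in both directions, hence
    equal by [ll_order_anti]; [greedy_label] puts this together. The recursion of the theorem is
    that of [greedy]: x nodes go down the first column of component [a i], until the required
    residue is that of the corner of the component [a j], whose charge is larger; from there the
    procedure for j takes over. For the first class it fills columns of height e - 1.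

    Multiplicities are controlled by products [linprod] of factors L_k - rho, with rho generic
    residues. Over the fraction field they are diagonal on the tableau basis, so a suitable one
    vanishes ([form_linprod_eq0]) or has rank one ([form_linprod_rank1]); both facts are identities
    over A and survive theta, while the same product is a nonzero scalar on M
    ([separating_products]). Vanishing excludes M from V^mu unless some mu-tableau has the weight of
    M. Rank one singles out one composition factor of V^lambda, which [peel] identifies with M
    ([comp_mult_eq1]).

    On the combinatorial side, [greedy_rigid] shows that lambda has one tableau of this weight and
    none with a repeated residue, and [dominated] compares contents node by node.
    [contents_dominance] turns this into the order on [kappa]: adding a node of content x replaces x
    - 1 by x among the beta numbers, and the sum of the t largest numbers is the minimum over z of
    tz plus the sum of max(x - z, 0). *)

Section JucysMurphy.
Variables (F : fieldType) (l : nat) (q : F) (Q : 'I_l -> F) (n : nat).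
Variable V : AKmodule q Q n.
Hypothesis q0 : q != 0.
Local Notation T := (AKact V).
Local Notation L := (jucys_murphy V).

Lemma jmS k : L k.+1 = q^-1 *: (T k.+1 *m L k *m T k.+1).
Proof. by []. Qed.

Lemma AK_quadratic i : (0 < i < n)%N -> T i *m T i = (q - 1) *: T i + q%:M.
Proof.
have [_ quad _ _ _] := AKactP V => /quad.
rewrite -[LHS]/((T i - q%:M) *m (T i + 1%:M)) mulmxBl !mulmxDr !mulmx1.
rewrite mul_scalar_mx => /eqP; rewrite subr_eq0 => /eqP E.
by apply: (addIr (T i)); rewrite E scalerBl scale1r addrAC subrK.
Qed.

Lemma AK_braid i : (0 < i)%N -> (i.+1 < n)%N ->
  T i *m T i.+1 *m T i = T i.+1 *m T i *m T i.+1.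
Proof. by have [_ _ _ braid _] := AKactP V; apply: braid. Qed.

Lemma AK_comm i j : (i < n)%N -> (j < n)%N -> ((i.+1 < j) || (j.+1 < i))%N ->
  T i *m T j = T j *m T i.
Proof.
have [_ _ _ _ comm] := AKactP V.
move=> lt_in lt_jn /orP[lt_ij|lt_ji]; first by apply: comm; rewrite lt_ij.
by symmetry; apply: comm; rewrite lt_ji.
Qed.

(** For j > k + 1 the generator commutes with every letter of [L k]. For j < k one descends to k = j
    + 1, where the braid relation (of length four if j = 0) carries [T j] through. *)
Lemma jm_commT k j : (k < n)%N -> (j < n)%N -> j != k -> j != k.+1 ->
  T j *m L k = L k *m T j.
Proof.
have far k' j' : (k'.+1 < j')%N -> (j' < n)%N -> T j' *m L k' = L k' *m T j'.
  elim: k' => [|k' IH] kj jn; first by apply: AK_comm => //; lia.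
  rewrite jmS -scalemxAr -scalemxAl; congr (_ *: _).
  have E : T j' *m T k'.+1 = T k'.+1 *m T j' by apply: AK_comm => //; lia.
  rewrite !mulmxA E -(mulmxA _ (T j')) IH //; last exact: ltn_trans kj.
  by rewrite -!mulmxA E.
have near k' j' : (j' < k')%N -> (k' < n)%N -> T j' *m L k' = L k' *m T j'.
  elim: k' => // k' IH; rewrite ltnS leq_eqVlt => /orP[/eqP->|jk] kn; last first.
    rewrite jmS -scalemxAr -scalemxAl; congr (_ *: _).
    have E : T j' *m T k'.+1 = T k'.+1 *m T j' by apply: AK_comm => //; lia.
    rewrite !mulmxA E -(mulmxA _ (T j')) IH //; last exact: ltnW.
    by rewrite -!mulmxA E.
  case: k' {IH} kn => [|k'] kn.
    have [_ _ /(_ kn) braid0 _ _] := AKactP V.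
    rewrite jmS -scalemxAr -scalemxAl; congr (_ *: _).
    have : T 0%N *m T 1%N *m (T 0%N *m T 1%N) = T 1%N *m T 0%N *m (T 1%N *m T 0%N).
      exact: braid0.
    by rewrite !mulmxA.
  have Br := AK_braid (ltn0Sn k') kn.
  rewrite !jmS -!(scalemxAr, scalemxAl); congr (_ *: (_ *: _)).
  rewrite !mulmxA Br -(mulmxA _ (T k'.+2) (L k')) (far k' k'.+2) //.
  rewrite -!mulmxA; do 3 congr (_ *m _).
  by rewrite !mulmxA Br.
move=> kn jn jk jk1; case: (ltngtP j k) jk => // [jk _|kj _]; first exact: near.
by apply: far => //; rewrite ltn_neqAle eq_sym jk1.
Qed.

Lemma jm_comm j k : (j < n)%N -> (k < n)%N -> L j *m L k = L k *m L j.
Proof.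
wlog jk : j k / (j <= k)%N => [H jn kn|].
  by case/orP: (leq_total j k) => jk; [|symmetry]; apply: H.
rewrite leq_eqVlt in jk; case/orP: jk => [/eqP->//|jk] _ kn.
elim: j jk => [|j IH] jk; first by apply: jm_commT => //; lia.
have E : T j.+1 *m L k = L k *m T j.+1 by apply: jm_commT => //; lia.
rewrite jmS -scalemxAl -scalemxAr; congr (_ *: _).
by rewrite !mulmxA -E -!mulmxA E !mulmxA -(mulmxA _ (L j)) IH ?mulmxA // ltnW.
Qed.

(** This relation and the next one are the Bernstein relations of the affine Hecke algebra; both
    come from the quadratic relation. *)
Lemma jmT k : (k.+1 < n)%N ->
  T k.+1 *m L k = L k.+1 *m T k.+1 - (q - 1) *: L k.+1.
Proof.
move=> kn; have -> : L k.+1 *m T k.+1 = (q - 1) *: L k.+1 + T k.+1 *m L k.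
  rewrite [in LHS]jmS -scalemxAl -(mulmxA _ (T _) (T _)) AK_quadratic //.
  rewrite mulmxDr -scalemxAr mul_mx_scalar scalerDr scalerA mulrC -scalerA -jmS.
  by rewrite [in X in _ + X = _]scalerA mulVf // scale1r.
by rewrite addrC addKr.
Qed.

Lemma Tjm k : (k.+1 < n)%N ->
  T k.+1 *m L k.+1 = L k *m T k.+1 + (q - 1) *: L k.+1.
Proof.
move=> kn; rewrite [in LHS]jmS -scalemxAr !mulmxA AK_quadratic //.
rewrite mulmxDl mulmxDl -!scalemxAl mul_scalar_mx -scalemxAl scalerDr scalerA mulrC.
rewrite -scalerA -jmS addrC; congr (_ + _).
by rewrite scalerA mulVf // scale1r.
Qed.

End JucysMurphy.

(** * Linear algebra modulo a subspace *)

Section LinearAlgebra.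
Variables (F : fieldType) (d : nat).
Implicit Types K Y Z D : 'M[F]_d.

Lemma sub_coker m1 m2 (A : 'M[F]_(m1, d)) (B : 'M[F]_(m2, d)) Y :
  (A *m cokermx Y <= B *m cokermx Y)%MS -> (A <= B + Y)%MS.
Proof.
case/submxP=> M E; have : (A - M *m B <= Y)%MS.
  by rewrite submxE mulmxBl E mulmxA subrr.
move=> AY; rewrite -[A](subrK (M *m B)) addrC.
exact: addmx_sub_adds (submxMl _ _) AY.
Qed.

(** Rank-nullity, with [cokermx Y] as projection modulo Y: if nothing of K outside Y is sent into Y,
    the image of K modulo Y loses no dimension. For stable Y: an injective endomorphism of K / Y is
    onto. *)
Lemma inj_surj_mod K Y D : (Y <= K)%MS -> (K *m D <= K)%MS ->
    (forall x : 'rV_d, (x <= K)%MS -> (x *m D <= Y)%MS -> (x <= Y)%MS) ->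
  (K <= K *m D + Y)%MS.
Proof.
move=> YK KD inj; apply: sub_coker; set C := cokermx Y.
have DC : (K *m D *m C <= K *m C)%MS by rewrite submxMr.
rewrite -(geq_leqif (mxrank_leqif_sup DC)).
rewrite -(leq_add2r (\rank (K :&: kermx (D *m C))%MS)) -[K *m D *m C]mulmxA.
rewrite mxrank_mul_ker -(mxrank_mul_ker K C) leq_add2l mxrankS //.
apply/row_subP => i; move: (row_sub i (K :&: kermx (D *m C))%MS).
rewrite sub_capmx sub_kermx mulmxA -submxE => /andP[xK xD].
by rewrite sub_capmx xK sub_kermx -submxE inj.
Qed.

(** Rank-nullity in the other direction: if the image of Z under D covers Z modulo K, there is no
    room for a vector outside K that is sent into K. *)
Lemma surj_inj_mod Z K D (x : 'rV_d) :
    (K *m D <= K)%MS -> (Z <= Z *m D + K)%MS ->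
  (x <= Z)%MS -> (x *m D <= K)%MS -> (x <= K)%MS.
Proof.
move=> KD surj xZ xD; set C := cokermx K.
have sub : (Z :&: kermx C <= Z :&: kermx (D *m C))%MS.
  apply: capmxS => //; apply/row_subP => i; move: (row_sub i (kermx C)).
  rewrite !sub_kermx mulmxA -!submxE => yK.
  by apply: submx_trans KD; rewrite submxMr.
have ZDC : (Z *m C <= Z *m D *m C)%MS.
  apply: submx_trans (submxMr C surj) _; rewrite addsmxMr.
  by rewrite mulmx_coker addsmx0.
have : (Z :&: kermx (D *m C) <= Z :&: kermx C)%MS.
  rewrite -(geq_leqif (mxrank_leqif_sup sub)) -(leq_add2l (\rank (Z *m C))).
  rewrite mxrank_mul_ker -(mxrank_mul_ker Z (D *m C)) leq_add2r mulmxA.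
  exact: mxrankS.
move/(submx_trans _) => /(_ _ x); rewrite !sub_capmx !sub_kermx mulmxA.
by rewrite -!submxE xZ xD => /(_ isT).
Qed.

Lemma sub_eigen (x : 'rV[F]_d) Y A a b :
  a != b -> (x *m (A - a%:M) <= Y)%MS -> (x *m (A - b%:M) <= Y)%MS -> (x <= Y)%MS.
Proof.
rewrite -subr_eq0 => ab xa xb.
have : ((a - b) *: x <= Y)%MS.
  have -> : (a - b) *: x = x *m (A - b%:M) - x *m (A - a%:M).
    by rewrite !mulmxBr !mul_mx_scalar opprB [RHS]addrC addrA subrK scalerBl.
  by rewrite addmx_sub // eqmx_opp.
by rewrite eqmx_scale.
Qed.

End LinearAlgebra.

(** * Simple modules with the weight of the sign module *)

Lemma stablemxZ (F : fieldType) d (K A : 'M[F]_d) (a : F) :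
  stablemx K A -> stablemx K (a *: A).
Proof. by rewrite -scalemxAr; apply: scalemx_sub. Qed.

(** Once the matrix products are opaque rows, the identities to be shown are linear in them and can
    be checked entrywise. *)
Ltac lmod_ring := repeat match goal with |- context [mulmx ?x ?y] =>
  let z := fresh "z" in set z := mulmx x y; clearbody z end;
  apply/rowP => ?; rewrite !mxE; ring.

Section Peeling.
Variables (F : fieldType) (l : nat) (q : F) (Q : 'I_l -> F) (n : nat).
Variable V : AKmodule q Q n.
Hypothesis q0 : q != 0.
Local Notation d := (AKdim V).
Local Notation T := (AKact V).
Local Notation L := (jucys_murphy V).
Implicit Types K X Z : 'M[F]_d.

Lemma submodule_jm (U : 'M[F]_d) k : submodule U -> (k < n)%N -> stablemx U (L k).
Proof.
move=> subU; elim: k => [|k IH] kn; first exact: subU.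
have sT : stablemx U (T k.+1) by apply: subU.
have sL : stablemx U (L k) by apply: IH; apply: ltnW.
by rewrite jmS; apply: stablemxZ; do !apply: stablemxM.
Qed.

(* Stability under the affine Hecke algebra on the strands m + 1, ..., n. *)
Definition tail_stable m K : Prop :=
  ((m < n)%N -> stablemx K (L m)) /\
  forall j, (m < j < n)%N -> stablemx K (T j).

Lemma tail_stableS m K : tail_stable m K -> tail_stable m.+1 K.
Proof.
move=> [KL KT]; split=> [mn|j jmn]; last by apply: KT; lia.
have KTm : stablemx K (T m.+1) by apply: KT; rewrite ltnS leqnn.
have KLm := KL (ltnW mn).
by rewrite jmS; apply: stablemxZ; do !apply: stablemxM.
Qed.

Lemma submodule_tail_stable m K : submodule K -> tail_stable m K.
Proof.
move=> sK; split; first exact: submodule_jm.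
by move=> j /andP[_]; apply: sK.
Qed.

(** As r varies, the words T_(m+1) ... T_(m+r) are the minimal length representatives of the right
    cosets of the symmetric group on the strands m + 2, ..., n in the one on m + 1, ..., n. *)
Fixpoint run m r : 'M[F]_d :=
  if r is r'.+1 then run m r' *m T (m + r'.+1) else 1%:M.

Lemma run_far m r i : (i < n)%N -> (m + r.+1 < i)%N ->
  run m r *m T i = T i *m run m r.
Proof.
elim: r => [|r IH] lt_in ri; first by rewrite mul1mx mulmx1.
by rewrite /= -mulmxA (AK_comm V (i := m + r.+1)) ?mulmxA ?IH //; lia.
Qed.

Lemma run_shift m r i : (m < i < m + r)%N -> (m + r < n)%N ->
  run m r *m T i = T i.+1 *m run m r.
Proof.
elim: r => [|r IH]; first by lia.
rewrite addnS ltnS => /andP[mi]; rewrite leq_eqVlt => /orP[/eqP ir|ir] rn; last first.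
  rewrite /= -mulmxA (AK_comm V (i := m + r.+1)) ?mulmxA ?IH //; lia.
case: r ir {IH} rn => [|r] ir rn; first by lia.
rewrite /= -ir -!mulmxA addnS -ir (mulmxA (T i)) AK_braid //; try lia.
by rewrite !mulmxA run_far //; lia.
Qed.

Lemma run_headE m r : run m r.+1 = T m.+1 *m run m.+1 r.
Proof.
elim: r => [|r IH]; first by rewrite /= addn1 mulmx1 mul1mx.
by rewrite -[run m r.+2]/(run m r.+1 *m _) IH -mulmxA addnS -addSn.
Qed.

Lemma run_jm m r : (m + r.+1 < n)%N -> run m.+1 r *m L m = L m *m run m.+1 r.
Proof.
elim: r => [|r IH] rn; first by rewrite mulmx1 mul1mx.
by rewrite /= -mulmxA jm_commT ?mulmxA ?IH //; lia.
Qed.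

Lemma tail_stable_run m r K : (m + r < n)%N -> tail_stable m K ->
  stablemx K (run m r).
Proof.
move=> + [_ KT]; elim: r => [|r IH] rn; first by rewrite mulmx1.
by apply: stablemxM; [apply: IH; lia | apply: KT; lia].
Qed.

(** For K stable under the tail algebra of m + 1, this is the span of K under the Hecke algebra on
    one more strand. *)
Definition run_span m K : 'M[F]_d := (\sum_(r < n - m) K *m run m r)%MS.

Lemma run_spanP m K r : (m + r < n)%N -> (K *m run m r <= run_span m K)%MS.
Proof.
move=> rn; have rnm : (r < n - m)%N by rewrite ltn_subRL.
exact: (sumsmx_sup (Ordinal rnm)).
Qed.

Lemma sub_run_span m K : (m < n)%N -> (K <= run_span m K)%MS.
Proof. by move=> mn; have := @run_spanP m K 0; rewrite addn0 mulmx1; apply. Qed.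

Lemma run_span_sub m K X : tail_stable m X -> (K <= X)%MS -> (run_span m K <= X)%MS.
Proof.
move=> sX KX; apply/sumsmx_subP => r _.
apply: submx_trans (submxMr _ KX) _; apply: tail_stable_run sX.
by have := ltn_ord r; rewrite ltn_subRL.
Qed.

(** [T j] either commutes with the run or passes through it as [T j.+1], and is absorbed by K; or it
    equals the last letter, and the quadratic relation applies; or it lengthens the run. *)
Lemma run_span_T m K j : (m < j < n)%N ->
    (forall i, (m.+1 < i < n)%N -> stablemx K (T i)) ->
  stablemx (run_span m K) (T j).
Proof.
move=> jmn KT; rewrite sumsmxMr; apply/sumsmx_subP => r _.
have rn : (m + r < n)%N by have := ltn_ord r; rewrite ltn_subRL.
case: (ltngtP (m + r).+1 j) => [rj|jr|rj].
- rewrite -mulmxA run_far ?addnS //; try lia.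
  by rewrite mulmxA; apply: submx_trans (submxMr _ (KT _ _)) (run_spanP _ _); lia.
- move: jr; rewrite ltnS leq_eqVlt => /orP[/eqP jr|jr].
    case: {-1}(r : nat) (erefl (r : nat)) => [|r'] Er; first by lia.
    have E : run m r'.+1 *m T j = (q - 1) *: run m r'.+1 + q *: run m r'.
      rewrite /= -Er -jr -mulmxA AK_quadratic; last by lia.
      by rewrite mulmxDr -scalemxAr mul_mx_scalar.
    rewrite -mulmxA E mulmxDr -!scalemxAr.
    by apply: addmx_sub; apply: scalemx_sub; apply: run_spanP; lia.
  rewrite -mulmxA run_shift //; try lia.
  by rewrite mulmxA; apply: submx_trans (submxMr _ (KT _ _)) (run_spanP _ _); lia.
- by rewrite -mulmxA -rj -addnS; apply: (run_spanP K (r := r.+1)); lia.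
Qed.

(** By the Bernstein relation [L m] passes the first letter of the run and becomes [L m.+1] acting
    on K. The run in the correction term starts one strand later, so it preserves a K stable under
    the tail algebra of m + 1. *)
Lemma run_jm_step K m r : (m + r.+1 < n)%N ->
  K *m run m r.+1 *m L m =
  K *m L m.+1 *m run m r.+1 - (q - 1) *: (K *m L m.+1 *m run m.+1 r).
Proof.
move=> rn; rewrite run_headE -!mulmxA run_jm // (mulmxA _ (L m)) jmT //; last by lia.
by rewrite mulmxBl -(scalemxAl (q - 1)) mulmxBr -(scalemxAr (q - 1)) !mulmxA.
Qed.

Lemma run_span_stable m K : (m < n)%N -> tail_stable m.+1 K -> stablemx K (L m) ->
  tail_stable m (run_span m K).
Proof.
move=> mn sK KL; split; last by move=> j jmn; apply: run_span_T => // i; apply: sK.2.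
move=> _; rewrite sumsmxMr; apply/sumsmx_subP => -[[|r] /= rnm] _.
  by rewrite mulmx1; apply: submx_trans KL (sub_run_span _ _).
have rn : (m + r.+1 < n)%N by rewrite -ltn_subRL.
rewrite run_jm_step //; apply: addmx_sub.
  by apply: submx_trans (submxMr _ (sK.1 _)) (run_spanP _ _); lia.
rewrite eqmx_opp; apply: scalemx_sub.
apply: submx_trans (submxMr _ (sK.1 _)) _; first by lia.
apply: submx_trans (tail_stable_run _ sK) (sub_run_span _ _); lia.
Qed.

(** By [run_jm_step], modulo K the operator [L m - a] on the translates of K by nontrivial runs is
    [L m.+1 - a] on K, which is onto modulo Y. *)
Lemma run_span_surj m K Y a : (m.+1 < n)%N -> tail_stable m.+1 K ->
    submodule Y -> (Y <= K)%MS -> (K <= K *m (L m.+1 - a%:M) + Y)%MS ->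
  (run_span m K <= run_span m K *m (L m - a%:M) + K)%MS.
Proof.
move=> mn sK sY YK surj; apply/sumsmx_subP => -[[|r] /= rnm] _.
  by rewrite mulmx1 addsmxSr.
have rn : (m + r.+1 < n)%N by rewrite -ltn_subRL.
have sKr : stablemx K (run m.+1 r) by apply: tail_stable_run sK; lia.
apply: submx_trans (submxMr _ surj) _; rewrite addsmxMr addsmx_sub; apply/andP; split; last first.
  apply: submx_trans (tail_stable_run rn (submodule_tail_stable _ sY)) _.
  exact: submx_trans YK (addsmxSr _ _).
have -> : K *m (L m.+1 - a%:M) *m run m r.+1 =
    K *m run m r.+1 *m (L m - a%:M) + (q - 1) *: (K *m L m.+1 *m run m.+1 r).
  rewrite mulmxBr mulmxBl !mul_mx_scalar mulmxBr run_jm_step // mul_mx_scalar.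
  by rewrite -scalemxAl addrAC addrNK.
apply: addmx_sub_adds; first by rewrite submxMr // run_spanP.
by apply: scalemx_sub; apply: submx_trans (submxMr _ (sK.1 mn)) sKr.
Qed.

Lemma run_comm_head m r : (m + r.+1 < n)%N ->
  run m.+1 r *m T m = T m *m run m.+1 r.
Proof.
elim: r => [|r IH] rn; first by rewrite mulmx1 mul1mx.
by rewrite /= -mulmxA (AK_comm V (i := (m.+1 + r.+1)%N)) ?mulmxA ?IH //; lia.
Qed.

Variables (Y : 'M[F]_d) (w : 'rV[F]_d) (c : nat -> F).
Hypothesis sY : submodule Y.
Hypothesis cS : forall k, (k.+1 < n)%N -> c k = q * c k.+1.
Hypothesis c_neq : forall k, (k.+1 < n)%N -> c k != c k.+1.
Hypothesis w_weight : forall k, (k < n)%N -> (w *m (L k - (c k)%:M) <= Y)%MS.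
Hypothesis wY : ~~ (w <= Y)%MS.

Lemma line_stable (A : 'M[F]_d) a (x : 'rV[F]_d) :
  stablemx Y A -> (x *m (A - a%:M) <= Y)%MS -> stablemx (x + Y)%MS A.
Proof.
move=> YA xA; rewrite addsmxMr addsmx_sub; apply/andP; split; last first.
  exact: submx_trans YA (addsmxSr _ _).
rewrite -[A](subrK a%:M) mulmxDr addrC mul_mx_scalar.
by apply: addmx_sub_adds; first exact: scalemx_sub.
Qed.

Lemma line_commute (A : 'M[F]_d) (B : 'M[F]_d) a :
    A *m B = B *m A -> stablemx Y A -> (w *m (B - a%:M) <= Y)%MS ->
  (w *m A *m (B - a%:M) <= Y)%MS.
Proof.
move=> AB YA wB; have -> : w *m A *m (B - a%:M) = w *m (B - a%:M) *m A.
  by rewrite !mulmxBr mulmxBl -!mulmxA AB !mul_mx_scalar mul_scalar_mx -scalemxAr.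
exact: submx_trans (submxMr _ wB) YA.
Qed.

Section Defect.
Variable m : nat.
Hypothesis mn : (m.+1 < n)%N.
Hypothesis wT : forall j, (m.+1 < j < n)%N -> (w *m (T j + 1%:M) <= Y)%MS.
(** The failure of w to be a sign vector for [T m.+1]. Modulo Y its weight is that of w with the
    entries m and m + 1 exchanged ([u_jmS], [u_jm]), so the tail-stable space Z generated by it and
    Y cannot contain w. *)
Let u := w *m (T m.+1 + 1%:M).
Let U := (u + Y)%MS.

Let YT1 : stablemx Y (T m.+1 + 1%:M).
Proof.
by rewrite mulmxDr mulmx1 addmx_sub // sY.
Qed.

Let u_comm A a : A *m T m.+1 = T m.+1 *m A -> (w *m (A - a%:M) <= Y)%MS ->
  (u *m (A - a%:M) <= Y)%MS.
Proof.
move=> AT; apply: line_commute => //.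
by rewrite mulmxDr mulmxDl mulmx1 mul1mx AT.
Qed.

Let u_T j : (m.+2 < j < n)%N -> (u *m (T j - (- 1)%:M) <= Y)%MS.
Proof.
move=> jmn; apply: u_comm; first by apply: AK_comm; lia.
by rewrite -scalemx1 scaleN1r opprK wT //; lia.
Qed.

Let U_stable : tail_stable m.+2 U.
Proof.
split=> [mn2|j jmn]; last first.
  by apply: line_stable (u_T jmn); apply: sY; lia.
apply: line_stable (u_comm _ (w_weight mn2)); first exact: submodule_jm.
by rewrite jm_commT //; lia.
Qed.

(** The relation [c m = q * c m.+1] is what makes w T + w an eigenvector: w T is sent to c_m w T +
    (q - 1) c_(m+1) w, and w to c_(m+1) w. *)
Let u_jmS : (u *m (L m.+1 - (c m)%:M) <= Y)%MS.
Proof.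
have y0 := w_weight (ltnW mn); have y1 := w_weight mn.
have -> : u *m (L m.+1 - (c m)%:M) =
    w *m (L m - (c m)%:M) *m T m.+1 + q *: (w *m (L m.+1 - (c m.+1)%:M)).
  rewrite /u !(mulmxBr, mulmxDr, mulmxBl, mulmxDl) mulmx1 !mul_mx_scalar.
  rewrite -!mulmxA Tjm // !mulmxDr -!(scalemxAr (q - 1)) -!scalemxAl cS //.
  by lmod_ring.
apply: addmx_sub; last exact: scalemx_sub.
by apply: submx_trans (submxMr _ y0) _; apply: sY.
Qed.

Let u_jm : (u *m (L m - (c m.+1)%:M) <= Y)%MS.
Proof.
have y0 := w_weight (ltnW mn); have y1 := w_weight mn.
have -> : u *m (L m - (c m.+1)%:M) = w *m (L m.+1 - (c m.+1)%:M) *m T m.+1 -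
    (q - 1) *: (w *m (L m.+1 - (c m.+1)%:M)) + w *m (L m - (c m)%:M).
  rewrite /u !(mulmxBr, mulmxDr, mulmxBl, mulmxDl) mulmx1 !mul_mx_scalar.
  rewrite -!mulmxA jmT // !mulmxBr -!(scalemxAr (q - 1)) -!(scalemxAl (c m.+1)).
  rewrite (cS mn).
  by lmod_ring.
apply: addmx_sub => //; apply: addmx_sub; last first.
  by rewrite eqmx_opp; apply: scalemx_sub.
by apply: submx_trans (submxMr _ y1) _; apply: sY.
Qed.

Let Z := run_span m.+1 U.

Let Z_stable : tail_stable m.+1 Z.
Proof. by apply: run_span_stable => //; apply: line_stable u_jmS; apply: submodule_jm. Qed.

Let Z_jm : (Z *m (L m - (c m.+1)%:M) <= Y)%MS.
Proof.
rewrite sumsmxMr; apply/sumsmx_subP => r _.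
have rn : (m + r.+1 < n)%N by have := ltn_ord r; lia.
have -> : U *m run m.+1 r *m (L m - (c m.+1)%:M) =
    U *m (L m - (c m.+1)%:M) *m run m.+1 r.
  by rewrite !mulmxBr mulmxBl -!mulmxA run_jm // !mul_mx_scalar mul_scalar_mx -scalemxAr.
have UY : (U *m (L m - (c m.+1)%:M) <= Y)%MS.
  rewrite addsmxMr addsmx_sub u_jm mulmxBr mul_mx_scalar addmx_sub //.
    by apply: submodule_jm => //; apply: ltnW.
  by rewrite eqmx_opp scalemx_sub.
apply: submx_trans (submxMr _ UY) _; apply: tail_stable_run; first by lia.
exact: submodule_tail_stable.
Qed.

(** Stability under [T m.+1] is not built into Z. It multiplies u by q; on longer runs the braid
    relation and w T_(m+2) = - w modulo Y turn u T_(m+2) T_(m+1) into - u T_(m+2) - u. *)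
Let u_run r : (m + r.+1 < n)%N -> (u *m run m.+1 r *m T m.+1 <= Z)%MS.
Proof.
case: r => [|r] rn.
  rewrite mulmx1; have -> : u *m T m.+1 = q *: u.
    rewrite /u !(mulmxDr, mulmxDl) mulmx1 -mulmxA AK_quadratic // mulmxDr.
    rewrite -(scalemxAr (q - 1)) mul_mx_scalar.
    by lmod_ring.
  apply: scalemx_sub; apply: submx_trans (addsmxSl _ _) (sub_run_span _ _); lia.
have mn2 : (m.+2 < n)%N by lia.
pose y := w *m (T m.+2 + 1%:M).
have yY : (y <= Y)%MS by apply: wT; lia.
have YT j : (j < n)%N -> stablemx Y (T j) by apply: sY.
rewrite run_headE mulmxA -mulmxA run_comm_head; last by lia.
rewrite !mulmxA.
have -> : u *m T m.+2 *m T m.+1 = - (u *m T m.+2) - u +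
    (y *m T m.+1 *m T m.+2 + y *m T m.+1 + y).
  have /= := @AK_braid _ _ _ _ _ V m.+1 isT mn2; rewrite -!mulmxA => braid.
  rewrite /u /y !(mulmxDr, mulmxDl) !mulmx1 !mul1mx braid.
  by lmod_ring.
rewrite !mulmxDl !mulNmx -(mulmxA u) -run_headE.
have YR x : (x <= Y)%MS -> (x *m run m.+2 r <= Z)%MS.
  move=> xY; apply: submx_trans (submxMr _ xY) _.
  apply: submx_trans (tail_stable_run _ (submodule_tail_stable _ sY)) _; first by lia.
  by apply: submx_trans (addsmxSr _ _) (sub_run_span _ _).
have yT : (y *m T m.+1 <= Y)%MS.
  by apply: submx_trans (submxMr _ yY) (YT _ _); apply: ltnW.
rewrite -!mulmxDl; do ![apply: addmx_sub]; rewrite ?eqmx_opp ?mulNmx ?eqmx_opp.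
- apply: submx_trans (submxMr _ (addsmxSl _ _)) (run_spanP _ _); lia.
- apply: submx_trans (submxMr _ (addsmxSl _ _)) _.
  apply: submx_trans (tail_stable_run _ U_stable) (sub_run_span _ _) => //; lia.
apply: YR; do ?[apply: addmx_sub] => //.
exact: submx_trans (submxMr _ yT) (YT _ _).
Qed.

Let Z_T : stablemx Z (T m.+1).
Proof.
rewrite sumsmxMr; apply/sumsmx_subP => r _.
have rn : (m + r.+1 < n)%N by have := ltn_ord r; lia.
rewrite -mulmxA !addsmxMr addsmx_sub mulmxA u_run //=.
apply: (submx_trans _ (submx_trans (addsmxSr u Y) (sub_run_span _ mn))).
rewrite mulmxA; apply: submx_trans (submxMr _ (tail_stable_run _ _)) _.
- by lia.
- exact: submodule_tail_stable.
exact: sY.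
Qed.

Lemma defect_stable : tail_stable m Z.
Proof.
split=> [_|j].
  rewrite -[L m](subrK (c m.+1)%:M) mulmxDr addmx_sub ?mul_mx_scalar ?scalemx_sub //.
  exact: submx_trans Z_jm (submx_trans (addsmxSr u Y) (sub_run_span _ mn)).
case: (ltngtP j m.+1) => [|mj /andP[_ jn]|-> _]; [by lia | | exact: Z_T].
by apply: Z_stable.2; rewrite mj.
Qed.

Lemma w_notin_defect : ~~ (w <= Z)%MS.
Proof.
apply/negP => wZ; have wm := submx_trans (submxMr (L m - (c m.+1)%:M) wZ) Z_jm.
by move/negP: wY; apply; apply: sub_eigen (c_neq mn) (w_weight (ltnW mn)) wm.
Qed.

Lemma sub_defect (X : 'M_d) : tail_stable m X -> (Y <= X)%MS -> (w <= X)%MS ->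
  (Z <= X)%MS.
Proof.
move=> sX YX wX; apply: run_span_sub; first exact: tail_stableS.
rewrite addsmx_sub YX andbT /u mulmxDr mulmx1 addmx_sub //.
by apply: submx_trans (submxMr _ wX) _; apply: sX.2; rewrite ltnS leqnn.
Qed.

Lemma mem_defect : (w *m (T m.+1 + 1%:M) <= Z)%MS.
Proof. exact: submx_trans (addsmxSl _ _) (sub_run_span _ mn). Qed.

Lemma base_defect : (Y <= Z)%MS.
Proof. exact: submx_trans (addsmxSr _ _) (sub_run_span _ mn). Qed.

End Defect.

(** Descending induction on m for a section X / Y that is simple over the tail algebra of m. The
    last hypothesis forbids weights beginning with c_0, ..., c_j, c_j. Passing to the c_m-eigenspace
    of [L m] keeps the section simple over the next tail algebra. *)
Lemma peel m X : (m < n)%N -> tail_stable m X -> (Y <= X)%MS -> (w <= X)%MS ->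
    (forall k, (k < m)%N -> (X *m (L k - (c k)%:M) <= Y)%MS) ->
    (forall K, tail_stable m K -> (Y <= K)%MS -> (K <= X)%MS ->
       (K <= Y)%MS \/ (X <= K)%MS) ->
    (forall j (x : 'rV_d), (j.+1 < n)%N -> (x <= X)%MS ->
       (forall k, (k <= j)%N -> (x *m (L k - (c k)%:M) <= Y)%MS) ->
       (x *m (L j.+1 - (c j)%:M) <= Y)%MS -> (x <= Y)%MS) ->
  (X <= w + Y)%MS /\
  forall j, (m < j < n)%N -> (w *m (T j + 1%:M) <= Y)%MS.
Proof.
move: {-1}(n - m)%N (leqnn (n - m)) => r; elim: r m X => [|r IH] m X nmr mn.
  by lia.
move=> sX YX wX Xc simX bad.
have line : (forall j, (m < j < n)%N -> (w *m (T j + 1%:M) <= Y)%MS) ->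
    (X <= w + Y)%MS.
  move=> wT; have sK : tail_stable m (w + Y)%MS.
    split=> [_|j jmn]; first by apply: line_stable (w_weight mn); apply: submodule_jm.
    apply: (@line_stable _ (- 1)); first by apply: sY; lia.
    by rewrite -scalemx1 scaleN1r opprK wT.
  case: (simX _ sK) => //; [exact: addsmxSr | by rewrite addsmx_sub wX |].
  by move=> KY; case/negP: wY; apply: submx_trans (addsmxSl _ _) KY.
have [mn1|] := ltnP m.+1 n; last first.
  move=> nm; have wT j : (m < j < n)%N -> (w *m (T j + 1%:M) <= Y)%MS by lia.
  by split; first exact: line.
(* The preimage in X of the c_m-eigenspace of [L m] on X / Y; the tail algebra of m + 1 commutes
   with [L m] and preserves it. *)
pose X' := (X :&: kermx ((L m - (c m)%:M) *m cokermx Y))%MS.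
have X'P p (A : 'M_(p, d)) : (A <= X')%MS =
    (A <= X)%MS && (A *m (L m - (c m)%:M) <= Y)%MS.
  by rewrite sub_capmx sub_kermx mulmxA -submxE.
have X'X : (X' <= X)%MS by exact: capmxSl.
have X'c : (X' *m (L m - (c m)%:M) <= Y)%MS.
  by have := X'P _ X'; rewrite submx_refl => /esym/andP[].
have X'st A : stablemx X A -> stablemx Y A -> A *m L m = L m *m A -> stablemx X' A.
  move=> XA YA AL; rewrite X'P (submx_trans (submxMr _ X'X) XA) /=.
  have -> : X' *m A *m (L m - (c m)%:M) = X' *m (L m - (c m)%:M) *m A.
    by rewrite !mulmxBr mulmxBl -!mulmxA AL !mul_mx_scalar mul_scalar_mx -scalemxAr.
  exact: submx_trans (submxMr _ X'c) YA.
have sX1 := tail_stableS sX.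
have sX' : tail_stable m.+1 X'.
  split=> [_|j jmn]; apply: X'st.
  - exact: sX1.1.
  - exact: submodule_jm.
  - by apply: jm_comm => //; apply: ltnW.
  - by apply: sX1.2.
  - by apply: sY; lia.
  have /andP[mj jn] := jmn; apply: jm_commT; rewrite ?mn // neq_ltn.
    by rewrite (ltnW mj) orbT.
  by rewrite mj orbT.
have YX' : (Y <= X')%MS.
  rewrite X'P YX mulmxBr mul_mx_scalar addmx_sub ?eqmx_opp ?scalemx_sub //.
  exact: submodule_jm.
have wX' : (w <= X')%MS by rewrite X'P wX w_weight.
have X'ck k : (k < m.+1)%N -> (X' *m (L k - (c k)%:M) <= Y)%MS.
  rewrite ltnS leq_eqVlt => /orP[/eqP->//|km].
  by apply: submx_trans (Xc _ km); rewrite submxMr.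
have nmr1 : (n - m.+1 <= r)%N by rewrite subnS -subn1 leq_subLR add1n.
have [||X'w wT] := IH m.+1 X' nmr1 mn1 sX' YX' wX' X'ck.
- move=> K sK YK KX'; case KY: (K <= Y)%MS; [by left | right].
  have KL : (K *m (L m - (c m)%:M) <= Y)%MS by apply: submx_trans X'c; rewrite submxMr.
  have KD := submx_trans KL YK.
  have KLm : stablemx K (L m).
    by rewrite -[L m](subrK (c m)%:M) mulmxDr addmx_sub ?mul_mx_scalar ?scalemx_sub.
  have KZ := sub_run_span K mn.
  have sZ := run_span_stable mn sK KLm.
  have ZX := run_span_sub sX (submx_trans KX' X'X).
  case: (simX _ sZ (submx_trans YK KZ) ZX) => [ZY|XZ].
    by rewrite (submx_trans KZ ZY) in KY.
  (* X is run_span m K; modulo K the operator L_m - c_m is onto, so injective, *)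
  (* there, because L_(m+1) - c_m is injective on K / Y.                       *)
  apply/row_subP => i; have := row_sub i X'; rewrite X'P => /andP[xX xc].
  apply: (surj_inj_mod KD _ (submx_trans xX XZ) (submx_trans xc YK)).
  apply: (run_span_surj mn1 sK sY YK); apply: inj_surj_mod YK _ _.
    rewrite mulmxBr addmx_sub ?eqmx_opp ?mul_mx_scalar ?scalemx_sub //.
    exact: sK.1.
  move=> x xK xb; have xX' := submx_trans xK KX'.
  apply: (bad m x mn1 (submx_trans xX' X'X)) => // k km.
  by apply: submx_trans (X'ck _ km); rewrite submxMr.
- move=> j x jn xX'; exact: bad jn (submx_trans xX' X'X).
(* Only j = m + 1 is new. The defect space lies between Y and X and misses w, so simplicity forces
   it into Y. *)
have wT' j : (m < j < n)%N -> (w *m (T j + 1%:M) <= Y)%MS.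
  have [-> _|jm jmn] := eqVneq j m.+1; last first.
    by apply: wT; case/andP: jmn => mj jn; rewrite jn andbT ltn_neqAle eq_sym jm.
  apply: submx_trans (mem_defect mn1) _.
  case: (simX _ (defect_stable mn1 wT) (base_defect mn1)) => //.
    exact: sub_defect.
  by move=> XZ; case/negP: (w_notin_defect mn1); apply: submx_trans XZ.
by split; first exact: line.
Qed.

End Peeling.

(** * Composition multiplicities of the sign module *)

Section LinearProducts.
Variables (R : comNzRingType) (d : nat).
Implicit Types (L : nat -> 'M[R]_d) (s : seq (nat * R)).

(** A pair (k, rho) in s stands for the factor L_k - rho; [scalprod c s] is the value of the product
    on a vector of weight c. *)
Fixpoint linprod L s : 'M[R]_d :=
  if s is p :: s' then (L p.1 - p.2%:M) *m linprod L s' else 1%:M.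

Definition scalprod (c : nat -> R) s : R := \prod_(p <- s) (c p.1 - p.2).

Lemma scalprod_cons c p s : scalprod c (p :: s) = (c p.1 - p.2) * scalprod c s.
Proof. exact: big_cons. Qed.

End LinearProducts.

Lemma linprod_map (R S : comNzRingType) (f : {rmorphism R -> S}) d
    (L : nat -> 'M[R]_d) s :
  map_mx f (linprod L s) =
  linprod (fun k => map_mx f (L k)) [seq (p.1, f p.2) | p <- s].
Proof.
elim: s => [|p s IH] /=; first exact: map_mx1.
by rewrite map_mxM map_mxB map_scalar_mx IH.
Qed.

Lemma linprod_mod (F : fieldType) d (L : nat -> 'M[F]_d) (c : nat -> F) s
    (Y : 'M[F]_d) (x : 'rV[F]_d) :
    (forall p, p \in s -> stablemx Y (L p.1)) ->
    (forall p, p \in s -> (x *m (L p.1 - (c p.1)%:M) <= Y)%MS) ->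
  (x *m linprod L s - scalprod c s *: x <= Y)%MS.
Proof.
elim: s => [|p s IH] YL xL; first by rewrite mulmx1 /scalprod big_nil scale1r subrr sub0mx.
have YLs r : r \in s -> stablemx Y (L r.1) by move=> rs; apply: YL; rewrite inE rs orbT.
have {}IH : (x *m linprod L s - scalprod c s *: x <= Y)%MS.
  by apply: IH => // r rs; apply: xL; rewrite inE rs orbT.
have YP : (Y *m linprod L s <= Y)%MS.
  elim: (s) YLs => [|r s' IHs] YLs; first by rewrite mulmx1.
  rewrite /= mulmxA; apply: submx_trans (submxMr _ _) (IHs _); last first.
    by move=> r' rs'; apply: YLs; rewrite inE rs' orbT.
  rewrite mulmxBr mul_mx_scalar addmx_sub ?eqmx_opp ?scalemx_sub //.
  by apply: YLs; rewrite mem_head.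
have xp := xL p (mem_head _ _); set e := c p.1 - p.2.
have -> : x *m linprod L (p :: s) - scalprod c (p :: s) *: x =
    x *m (L p.1 - (c p.1)%:M) *m linprod L s +
    e *: (x *m linprod L s - scalprod c s *: x).
  rewrite scalprod_cons scalerBr scalerA addrA; congr (_ - _).
  rewrite scalemxAl -mulmxDl [in LHS]/= mulmxA; congr (_ *m _).
  by rewrite !mulmxBr !mul_mx_scalar scalerBl addrA subrK.
apply: addmx_sub; last exact: scalemx_sub.
exact: submx_trans (submxMr _ xp) YP.
Qed.

Section CompositionSeries.
Variables (F : fieldType) (l : nat) (q : F) (Q : 'I_l -> F) (n : nat).
Implicit Types V M : AKmodule q Q n.

Lemma submodule0 V : submodule (0 : 'M_(AKdim V)).
Proof. by move=> i _; rewrite mul0mx. Qed.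

Lemma submodule1 V : submodule (1%:M : 'M_(AKdim V)).
Proof. by move=> i _; apply: submx1. Qed.

(** Induction on the rank: below X one puts a proper submodule of maximal rank, which leaves no
    submodule strictly in between. *)
Lemma chain_exists V (X : 'M_(AKdim V)) : submodule X ->
  exists (r : nat) (U : nat -> 'M[F]_(AKdim V)),
  [/\ U 0%N = 0, (U r == X)%MS,
      forall i, (i <= r)%N -> submodule (U i)
    & forall i, (i < r)%N -> (U i < U i.+1)%MS /\
        forall W : 'M[F]_(AKdim V), submodule W ->
          (U i <= W)%MS -> (W <= U i.+1)%MS ->
          (W == U i)%MS \/ (W == U i.+1)%MS].
Proof.
move: {-1}(\rank X) (leqnn (\rank X)) => k; elim: k X => [|k IH] X rX sX.
  exists 0%N, (fun=> 0); split=> //; last by move=> i _; apply: submodule0.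
  by move: rX; rewrite leqn0 mxrank_eq0 => /eqP->; rewrite submx_refl.
have [X0|X0] := eqVneq X 0.
  by apply: (IH X) => //; rewrite X0 mxrank0.
pose P m := `[< exists Y : 'M_(AKdim V), [/\ submodule Y, (Y < X)%MS & \rank Y = m] >].
have P0 : exists m, P m.
  exists 0%N; apply/asboolP; exists 0; rewrite mxrank0.
  split=> //; first exact: submodule0.
  by rewrite ltmxE sub0mx submx0.
have Pb m : P m -> (m <= \rank X)%N.
  by case/asboolP => Y [_ /ltmxW/mxrankS + <-].
case: (ex_maxnP P0 Pb) => m /asboolP[Y [sY YX rY]] mmax.
have [|r [U [U0 UY Us Uc]]] := IH Y _ sY.
  by rewrite -ltnS; apply: leq_trans (rank_ltmx YX) rX.
exists r.+1, (fun i => if (i <= r)%N then U i else X); split=> //.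
- by rewrite ltnn submx_refl.
- by move=> i; case: ifP => [/Us//|_ _].
move=> i; rewrite ltnS => ir; move: (ir); rewrite {1}leq_eqVlt => /orP[/eqP->|{}ir]; last first.
  by rewrite /= ir (ltnW ir); apply: Uc.
rewrite /= leqnn ltnn; have [UrY YUr] := andP UY; split.
  by apply: sub_ltmx_trans UrY YX.
move=> W sW UW WX; case XW: (X <= W)%MS; [by right; rewrite WX | left].
rewrite UW andbT; apply: (submx_trans _ YUr).
have WltX : (W < X)%MS by rewrite ltmxE WX XW.
have : (\rank W <= m)%N by apply: mmax; apply/asboolP; exists W.
by rewrite -rY -(geq_leqif (mxrank_leqif_sup (submx_trans YUr UW))).
Qed.

Lemma composition_series_exists V :
  exists (r : nat) (U : nat -> 'M[F]_(AKdim V)), composition_series r U.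
Proof.
have [r [U [U0 /andP[_ U1] Us Uc]]] := chain_exists (@submodule1 V).
by exists r, U; split=> //; rewrite -sub1mx.
Qed.

Lemma composition_series_mono V r (U : nat -> 'M[F]_(AKdim V)) i k :
  composition_series r U -> (i <= k <= r)%N -> (U i <= U k)%MS.
Proof.
case=> _ _ _ Uc; elim: k => [|k IH] /andP[ik kr].
  by move: ik; rewrite leqn0 => /eqP->.
move: ik; rewrite leq_eqVlt => /orP[/eqP->//|ik].
apply: submx_trans (IH _) (ltmxW (Uc _ _).1) => //; lia.
Qed.

End CompositionSeries.

Section SignMultiplicity.
Variables (F : fieldType) (l : nat) (q : F) (Q : 'I_l -> F) (n : nat).
Variables V M : AKmodule q Q n.
Hypothesis q0 : q != 0.
Local Notation T := (AKact V).
Local Notation L := (jucys_murphy V).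
Variable c : nat -> F.
Hypothesis n0 : (0 < n)%N.
Hypothesis cS : forall k, (k.+1 < n)%N -> c k = q * c k.+1.
Hypothesis M_T0 : AKact M 0%N = (c 0%N)%:M.
Hypothesis M_T : forall j, (0 < j < n)%N -> AKact M j = (-1)%:M.

(** A morphism to M turns each [L k] into its scalar on M, which is [c k] because the two signs of
    [T k] cancel and [c] drops by a factor q. *)
Lemma intertwine_jm (U : 'M_(AKdim V)) (g : 'M_(AKdim V, AKdim M)) k :
    submodule U ->
    (forall i, (i < n)%N -> U *m T i *m g = U *m g *m AKact M i) ->
  (k < n)%N -> U *m L k *m g = c k *: (U *m g).
Proof.
move=> sU Ug.
suff H : forall k, (k < n)%N ->
    forall B : 'M_(AKdim V), (B <= U)%MS -> B *m L k *m g = c k *: (B *m g).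
  by move=> kn; apply: H.
have UT j a : (j < n)%N -> AKact M j = a%:M ->
    forall B : 'M_(AKdim V), (B <= U)%MS -> B *m T j *m g = a *: (B *m g).
  move=> jn E B /submxP[D ->].
  by rewrite -!mulmxA (mulmxA U) Ug // E mul_mx_scalar -scalemxAr.
elim=> [|{}k IH] kn B BU; first by rewrite (UT 0%N _ n0 M_T0).
have stT (C : 'M_(AKdim V)) : (C <= U)%MS -> (C *m T k.+1 <= U)%MS.
  by move=> CU; apply: submx_trans (submxMr _ CU) (sU _ kn).
have stL (C : 'M_(AKdim V)) : (C <= U)%MS -> (C *m L k <= U)%MS.
  by move=> CU; apply: submx_trans (submxMr _ CU) (submodule_jm sU (ltnW kn)).
rewrite jmS -scalemxAr -scalemxAl !mulmxA.
rewrite (UT k.+1 _ kn (M_T _)) ?(stL, stT) // IH ?stT ?(ltnW kn) //.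
rewrite (UT k.+1 _ kn (M_T _)) // !scalerA; congr (_ *: _).
by rewrite (cS kn); field.
Qed.

Lemma intertwine_linprod (U : 'M_(AKdim V)) (g : 'M_(AKdim V, AKdim M)) s :
    submodule U ->
    (forall i, (i < n)%N -> U *m T i *m g = U *m g *m AKact M i) ->
    (forall p, p \in s -> (p.1 < n)%N) ->
  U *m linprod L s *m g = scalprod c s *: (U *m g).
Proof.
move=> sU Ug; elim: s => [|p s IH] sn.
  by rewrite mulmx1 /scalprod big_nil scale1r.
have pn : (p.1 < n)%N by apply: sn; rewrite mem_head.
have {}IH := IH (fun r rs => sn r (@mem_behead _ (p :: s) r rs)).
have /submxP[D E] : (U *m (L p.1 - p.2%:M) <= U)%MS.
  rewrite mulmxBr mul_mx_scalar addmx_sub ?eqmx_opp ?scalemx_sub //.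
  exact: submodule_jm.
rewrite [linprod _ _]/= (mulmxA U) E -!mulmxA (mulmxA U) IH -scalemxAr mulmxA -E.
rewrite mulmxBr mulmxBl mul_mx_scalar intertwine_jm // -scalemxAl -scalerBl.
by rewrite scalerA scalprod_cons mulrC.
Qed.

(** M is a quotient of a submodule of V, so a product of factors L_k - rho that is zero on V is zero
    on M. *)
Lemma comp_mult_neq0_scalprod s : AKdim M = 1%N ->
    comp_mult V M <> 0%N -> (forall p, p \in s -> (p.1 < n)%N) ->
  linprod L s = 0 -> scalprod c s = 0.
Proof.
move=> dM; rewrite /comp_mult; case: xgetP => [k _|//].
case=> r [U [[U0 U1 Us Uc] ->]] kn0 sn Z0.
have [i /asboolP[g [Ug Ufull _]]] : exists i : 'I_r, `[< quotient_iso (U i) (U i.+1) M >].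
  case: (pickP [pred i : 'I_r | `[< quotient_iso (U i) (U i.+1) M >]]).
    by move=> i Hi; exists i.
  by move=> /eq_card0.
have := intertwine_linprod (Us i.+1 (ltn_ord i)) Ug sn.
rewrite Z0 mulmx0 mul0mx => /esym/eqP; rewrite scaler_eq0 => /orP[/eqP//|/eqP Ug0].
by move: Ufull; rewrite Ug0 /row_full mxrank0 dM.
Qed.

End SignMultiplicity.

Section SignMultiplicityOne.
Variables (F : fieldType) (l : nat) (q : F) (Q : 'I_l -> F) (n : nat).
Variables V M : AKmodule q Q n.
Hypothesis q0 : q != 0.
Local Notation T := (AKact V).
Local Notation L := (jucys_murphy V).
Variable c : nat -> F.
Hypothesis n0 : (0 < n)%N.
Hypothesis cS : forall k, (k.+1 < n)%N -> c k = q * c k.+1.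
Hypothesis c_neq : forall k, (k.+1 < n)%N -> c k != c k.+1.
Hypothesis M_dim : AKdim M = 1%N.
Hypothesis M_T0 : AKact M 0%N = (c 0%N)%:M.
Hypothesis M_T : forall j, (0 < j < n)%N -> AKact M j = (-1)%:M.
Variables (s : seq (nat * F)) (col : 'cV[F]_(AKdim V)) (w : 'rV[F]_(AKdim V)).
Hypothesis sn : forall p, p \in s -> (p.1 < n)%N.
Hypothesis s_rank1 : linprod L s = col *m w.
Hypothesis w_col : w *m col = (scalprod c s)%:M.
Hypothesis s_neq0 : scalprod c s != 0.
Hypothesis w_weight : forall k, (k < n)%N -> w *m L k = c k *: w.
Hypothesis no_repeat : forall j (Y : 'M_(AKdim V)) (x : 'rV_(AKdim V)),
  (j.+1 < n)%N -> submodule Y ->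
  (forall k, (k <= j)%N -> (x *m (L k - (c k)%:M) <= Y)%MS) ->
  (x *m (L j.+1 - (c j)%:M) <= Y)%MS -> (x <= Y)%MS.

Let stable_s (U : 'M_(AKdim V)) : submodule U -> (U *m col *m w <= U)%MS.
Proof.
move=> sU; rewrite -mulmxA -s_rank1; elim: (s) sn => [|p s' IH] sn'.
  by rewrite mulmx1.
rewrite /= mulmxA; apply: submx_trans (submxMr _ _) (IH _); last first.
  by move=> r rs; apply: sn'; rewrite inE rs orbT.
rewrite mulmxBr mul_mx_scalar addmx_sub ?eqmx_opp ?scalemx_sub //.
by apply: submodule_jm => //; apply: sn'; rewrite mem_head.
Qed.

Let w_sub (U : 'M_(AKdim V)) : submodule U -> U *m col != 0 -> (w <= U)%MS.
Proof.
move=> sU; have [i Ui _|U0 /eqP[]] := pickP (fun i => (U *m col) i 0 != 0); last first.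
  by apply/colP => i; rewrite [RHS]mxE; apply/eqP/negbFE/U0.
have := row_sub i (U *m col *m w); rewrite row_mul => /submx_trans/(_ (stable_s sU)).
have -> : row i (U *m col) = ((U *m col) i 0)%:M.
  by apply/rowP => j; rewrite ord1 !mxE eqxx mulr1n.
by rewrite mul_scalar_mx eqmx_scale.
Qed.

Let w_notin (U : 'M_(AKdim V)) : U *m col = 0 -> ~~ (w <= U)%MS.
Proof.
move=> U0; apply/negP => /submxP[D E]; case/eqP: s_neq0.
have := w_col; rewrite E -mulmxA U0 mulmx0 => /matrixP/(_ 0 0).
by rewrite !mxE eqxx mulr1n.
Qed.

(** The isomorphism is multiplication by [col]: it kills Y and sends w to the nonzero number
    [scalprod c s], while [peel] with m = 0 shows that X / Y is the line of w with the sign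
    action. *)
Let quotient_sign (Y X : 'M_(AKdim V)) : submodule Y -> submodule X -> (Y <= X)%MS ->
    Y *m col = 0 -> (w <= X)%MS ->
    (forall W : 'M_(AKdim V), submodule W -> (Y <= W)%MS -> (W <= X)%MS ->
       (W == Y)%MS \/ (W == X)%MS) ->
  quotient_iso Y X M.
Proof.
move=> sY sX YX Y0 wX simX.
have wm k : (k < n)%N -> (w *m (L k - (c k)%:M) <= Y)%MS.
  by move=> kn; rewrite mulmxBr mul_mx_scalar w_weight // subrr sub0mx.
have [||||||Xw wT] := peel q0 sY cS c_neq wm (w_notin Y0) (m := 0%N) (X := X) n0.
- exact: submodule_tail_stable.
- by [].
- by [].
- by [].
- move=> K sK YK KX; have sK' : submodule K.
    by move=> [|i] ni; [exact: (sK.1 ni) | exact: (sK.2 i.+1 ni)].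
  by case: (simX K sK' YK KX) => /andP[]; [left | right].
- by move=> j x jn _; apply: no_repeat.
(* M is taken apart so that its dimension becomes literally 1 and [col] has the type of a map to
   M. *)
move: M M_dim M_T0 M_T => [dM TM relM] /= dM1; case: _ / (esym dM1) TM relM => TM relM MT0 MT.
have w0 k : (k < n)%N -> w *m T k *m col = w *m col *m TM k.
  case: k => [|k] kn.
    by rewrite -[T 0%N]/(L 0%N) w_weight // MT0 mul_mx_scalar scalemxAl.
  rewrite MT // mul_mx_scalar scaleN1r.
  have /submxP[D E] := wT k.+1 kn.
  have : w *m (T k.+1 + 1%:M) *m col = 0 by rewrite E -mulmxA Y0 mulmx0.
  by rewrite mulmxDr mulmx1 mulmxDl => /eqP; rewrite addr_eq0 => /eqP.
exists col; split.
- move=> i ni; have /sub_addsmxP[[A B] /= E] := Xw.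
  have /submxP[D ED] := sY i ni.
  have YT0 : Y *m T i *m col = 0 by rewrite ED -mulmxA Y0 mulmx0.
  rewrite E !mulmxDl -(mulmxA B Y (T i)) -(mulmxA B _ col) YT0 -(mulmxA B Y col) Y0.
  by rewrite !mulmx0 mul0mx !addr0 -(mulmxA A w (T i)) -(mulmxA A) w0 // !mulmxA.
- rewrite -sub1mx; have : (w *m col <= X *m col)%MS by rewrite submxMr.
  by rewrite w_col -(scalemx1 _ (scalprod c s)) (eqmx_scale _ s_neq0).
move=> u uX; have := submx_trans uX Xw => /sub_addsmxP[[A B] /= ->].
rewrite mulmxDl -!mulmxA Y0 mulmx0 addr0 w_col mul_mx_scalar scalemx_eq0 (negbTE s_neq0) /=.
have BY : (B *m Y <= Y)%MS by rewrite submxMl.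
apply/eqP/idP => [->|]; first by rewrite mul0mx add0r.
move=> AB; have : (A *m w <= Y)%MS.
  by rewrite -[A *m w](addrK (B *m Y)) addmx_sub // eqmx_opp.
have -> : A = (A 0 0)%:M by apply/rowP => i; rewrite ord1 !mxE eqxx mulr1n.
rewrite mul_scalar_mx; have [->|A0] := eqVneq (A 0 0) 0; first by rewrite raddf0.
by rewrite eqmx_scale // => wY; case/negP: (w_notin Y0).
Qed.

(** Let U_(i+1) be the first term of a composition series not killed by [col]; it is also the first
    to contain w, and its factor is M. On any factor isomorphic to M the operator [col *m w] is a
    nonzero scalar, but it is zero on the factors below i (there [col] vanishes) and above i (there
    w is already divided out). *)
Lemma comp_mult_eq1 : comp_mult V M = 1%N.
Proof.
suff H r (U : nat -> 'M[F]_(AKdim V)) : composition_series r U ->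
    #|[pred i : 'I_r | `[< quotient_iso (U i) (U i.+1) M >]]| = 1%N.
  apply: xget_unique => [|k [r [U [/H E ->]]] //].
  by have [r [U sU]] := composition_series_exists V; exists r, U; rewrite H.
move=> sU; have [U0 Ur Us Uc] := sU.
have ex : exists j, (j <= r)%N && (U j *m col != 0).
  exists r; rewrite leqnn; apply: contra s_neq0 => /eqP Ucol.
  have := w_notin Ucol; suff -> : (w <= U r)%MS by [].
  exact: submx_full.
case: (ex_minnP ex) => -[|i] /andP[ir Ui] imin.
  by rewrite U0 mul0mx eqxx in Ui.
have Ui0 : U i *m col = 0.
  by apply/eqP; apply: contraTT (ltnSn i) => Uin; rewrite -leqNgt imin // (ltnW ir).
have wU := w_sub (Us _ ir) Ui.
have iP : quotient_iso (U i) (U i.+1) M.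
  apply: quotient_sign => //; [exact: Us (ltnW ir) | exact: Us | | exact: (Uc i ir).2].
  exact: ltmxW (Uc i ir).1.
rewrite (@eq_card1 _ (Ordinal ir)) // => k; rewrite !inE -val_eqE /=.
apply/asboolP/eqP => [[g [Ug Ufull gK]]|E]; last by rewrite E.
have := intertwine_linprod q0 n0 cS M_T0 M_T (Us _ (ltn_ord k)) Ug sn.
rewrite s_rank1 mulmxA => Eg.
have Ug0 : U k.+1 *m col *m w *m g != 0.
  rewrite Eg scaler_eq0 (negbTE s_neq0) /=; apply: contraL Ufull => /eqP->.
  by rewrite /row_full mxrank0 M_dim.
have ik : (i <= k)%N.
  have : (i.+1 <= k.+1)%N; last by [].
  apply: imin; rewrite ltn_ord; apply: contra Ug0 => /eqP->.
  by rewrite !mul0mx.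
apply/eqP; rewrite eqn_leq ik andbT leqNgt; apply/negP => ik'.
have wk : (w <= U k)%MS.
  by apply: submx_trans wU (composition_series_mono sU _); rewrite ik' ltnW.
have := gK w (submx_trans wk (ltmxW (Uc k (ltn_ord k)).1)); rewrite wk => /eqP wg.
by rewrite -mulmxA wg mulmx0 eqxx in Ug0.
Qed.

End SignMultiplicityOne.

(** * Specialization of the generic weights *)

Section DiagonalForm.
Variables (K : fieldType) (d : nat) (L : nat -> 'M[K]_d) (P : 'M[K]_d).
Variable r : 'I_d -> nat -> K.
Hypothesis P_unit : P \in unitmx.
Variable n : nat.
Hypothesis P_eigen : forall i k, (k < n)%N -> row i P *m L k = r i k *: row i P.
Implicit Types s : seq (nat * K).

Lemma linprod_eigen s i : (forall p, p \in s -> (p.1 < n)%N) ->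
  row i P *m linprod L s = scalprod (r i) s *: row i P.
Proof.
elim: s => [|p s IH] sn; first by rewrite mulmx1 /scalprod big_nil scale1r.
rewrite /= mulmxA mulmxBr mul_mx_scalar P_eigen ?sn ?mem_head // -scalerBl.
rewrite -scalemxAl IH ?scalerA ?scalprod_cons // => r' rs.
by apply: sn; rewrite inE rs orbT.
Qed.

Lemma linprod_eq0 s : (forall p, p \in s -> (p.1 < n)%N) ->
  (forall i, exists k, (k, r i k) \in s) -> linprod L s = 0.
Proof.
move=> sn sr; apply: (can_inj (mulKmx P_unit)); rewrite mulmx0.
apply/row_matrixP => i; rewrite row_mul row0 linprod_eigen //.
have [k ks] := sr i; rewrite /scalprod (big_rem _ ks) /= subrr mul0r scale0r //.
Qed.

(** Every eigenvector but row i0 is killed by a factor, which leaves a multiple of the projection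
    onto that row. *)
Lemma linprod_rank1 s i0 : (forall p, p \in s -> (p.1 < n)%N) ->
  (forall i, i != i0 -> exists k, (k, r i k) \in s) ->
  linprod L s = scalprod (r i0) s *: (col i0 (invmx P) *m row i0 P).
Proof.
move=> sn sr; apply: (can_inj (mulKmx P_unit)).
apply/row_matrixP => i; rewrite row_mul linprod_eigen // -scalemxAr linearZ /=.
have -> : row i (P *m (col i0 (invmx P) *m row i0 P)) = (i == i0)%:R *: row i0 P.
  rewrite mulmxA row_mul colE mulmxA mulmxV // mul1mx -mul_scalar_mx; congr (_ *m _).
  by apply/rowP => j; rewrite ord1 !mxE !eqxx mulr1n andbT.
have [->|ii0] := eqVneq i i0; first by rewrite scale1r.
have [k ks] := sr i ii0; rewrite scale0r scaler0.
by rewrite /scalprod (big_rem _ ks) /= subrr mul0r scale0r.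
Qed.

End DiagonalForm.

(** The generic factorization of a rank one matrix may have denominators that theta kills. Vanishing
    of the 2 by 2 minors does specialize, and with a nonzero diagonal entry it yields a
    factorization afterwards. *)
Lemma rank1_factor (F : fieldType) d (Z : 'M[F]_d) :
  (forall i j k m, Z i j * Z k m = Z i m * Z k j) -> \tr Z != 0 ->
  exists (x : 'cV[F]_d) (i : 'I_d), Z = x *m row i Z /\ row i Z *m x = (\tr Z)%:M.
Proof.
move=> minors tr0; have [i Zi|Z0] := pickP (fun i => Z i i != 0); last first.
  by case/eqP: tr0; rewrite /mxtrace big1 // => i _; apply/eqP/negbFE/Z0.
exists (\col_k (Z k i / Z i i)), i; split.
  apply/matrixP => k j; rewrite mxE big_ord1 !mxE mulrAC minors mulrK ?unitfE //.
apply/rowP => j; rewrite ord1 !mxE eqxx mulr1n; apply: eq_bigr => k _.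
by rewrite !mxE mulrA minors mulrAC mulfV ?mul1r.
Qed.

Section Specialization.
Variables (F : fieldType) (l : nat) (eta : F) (s : 'I_l -> int).
Variable theta : {rmorphism laurent l F -> F}.
Hypothesis theta_spec : is_specialization eta s theta.
Hypothesis eta0 : eta != 0.
Local Notation A := (laurent l F).
Local Notation iota := (val : {rmorphism laurent l F -> ratfun l F}).

Lemma is_laurent_qinv : is_laurent (ratfun_mpoly 'X_ord0 : ratfun l F)^-1.
Proof.
by apply/asboolP; exists 1, 1%N; rewrite expr1 [ratfun_mpoly 1]tofrac1 mul1r.
Qed.

Definition laurent_qinv : A := Laurent is_laurent_qinv.

Lemma val_qinv : iota laurent_qinv = (iota (laurent_q l F))^-1.
Proof. by []. Qed.

Lemma val_q_neq0 : iota (laurent_q l F) != 0.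
Proof. exact: ratfun_q_neq0. Qed.

Lemma laurent_qK : laurent_q l F * laurent_qinv = 1.
Proof.
by apply: val_inj; rewrite /= mulfV // ratfun_q_neq0.
Qed.

Lemma theta_q : theta (laurent_q l F) = eta.
Proof. by case: theta_spec. Qed.

Lemma theta_qinv : theta laurent_qinv = (theta (laurent_q l F))^-1.
Proof.
have q0 : theta (laurent_q l F) != 0 by rewrite theta_q.
by apply: (mulfI q0); rewrite mulfV // -rmorphM laurent_qK rmorph1.
Qed.

Definition laurent_residue (x : node l) : A :=
  let: (a, b, c) := x in laurent_Q F c * (laurent_q l F ^+ b * laurent_qinv ^+ a).

Definition node_weight (x : node l) : int :=
  let: (a, b, c) := x in s c + b%:Z - a%:Z.

Lemma val_residue x :
  iota (laurent_residue x) = residue (iota (laurent_q l F)) (iota \o @laurent_Q l F) x.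
Proof.
case: x => [[a b] c]; rewrite /residue rmorphM rmorphM !rmorphXn val_qinv /=.
by rewrite exprVn exprnN exprnP -expfzDr ?val_q_neq0.
Qed.

Lemma theta_residue x : theta (laurent_residue x) = eta ^ node_weight x.
Proof.
case: x => [[a b] c]; have [_ _ thQ] := theta_spec.
rewrite rmorphM rmorphM !rmorphXn theta_qinv theta_q thQ /node_weight.
by rewrite exprVn exprnN exprnP -addrA !expfzDr.
Qed.

Section Module.
Variables (n : nat) (V : AKmodule (laurent_q l F) (@laurent_Q l F) n).
Local Notation W := (base_change theta V).

(** The Jucys-Murphy elements over A itself, mapping to those of the generic and of the specialized
    module. *)
Fixpoint laurent_jm k : 'M[A]_(AKdim V) :=
  if k is k'.+1 then laurent_qinv *: (AKact V k *m laurent_jm k' *m AKact V k)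
  else AKact V 0%N.

Lemma val_jm k : map_mx iota (laurent_jm k) = jucys_murphy (base_change iota V) k.
Proof.
elim: k => [//|k IH]; rewrite [LHS]map_mxZ [jucys_murphy _ _]jmS -IH val_qinv.
by rewrite !map_mxM.
Qed.

Lemma theta_jm k : map_mx theta (laurent_jm k) = jucys_murphy W k.
Proof.
elim: k => [//|k IH]; rewrite [LHS]map_mxZ [jucys_murphy _ _]jmS -IH theta_qinv.
by rewrite !map_mxM.
Qed.

Variable lambda : mpart l.
Hypothesis formV : is_form lambda V.

Lemma map_val_inj m p (X Y : 'M[A]_(m, p)) : map_mx iota X = map_mx iota Y -> X = Y.
Proof.
move=> E; apply/matrixP => i j; apply: val_inj.
by have /matrixP/(_ i j) := E; rewrite !mxE.
Qed.

Lemma form_eigen : exists (P : 'M[ratfun l F]_(AKdim V))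
    (tab : 'I_(AKdim V) -> {ffun 'I_n -> node l}),
  [/\ P \in unitmx, injective tab,
      forall t, standard_tableau lambda t <-> exists i, tab i = t
    & forall i (k : 'I_n), row i P *m map_mx iota (laurent_jm k) =
        iota (laurent_residue (tab i k)) *: row i P].
Proof.
have [_ [P [tab [Pu tabI tabP eig]]]] := formV.
exists P, tab; split=> // i k.
by have := eig i k; rewrite -val_jm => ->; rewrite val_residue.
Qed.

Let resn (t : {ffun 'I_n -> node l}) (k : nat) : A :=
  if insub k is Some k' then laurent_residue (t k') else 0.

Let resnE t (k : 'I_n) : resn t k = laurent_residue (t k).
Proof. by rewrite /resn valK. Qed.

Variable S : seq (nat * A).
Hypothesis Sn : forall p, p \in S -> (p.1 < n)%N.

Let iS := [seq (p.1, iota p.2) | p <- S].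

Let iSn p : p \in iS -> (p.1 < n)%N.
Proof. by case/mapP => r /Sn rn ->. Qed.

Lemma form_linprod_eq0 :
    (forall t, standard_tableau lambda t ->
       exists k : 'I_n, (val k, laurent_residue (t k)) \in S) ->
  linprod laurent_jm S = 0.
Proof.
move=> St; have [P [tab [Pu tabI tabP eig]]] := form_eigen.
apply: map_val_inj; rewrite linprod_map map_mx0.
apply: (@linprod_eq0 _ _ _ P (fun i k => iota (resn (tab i) k)) Pu n) => //.
  by move=> i k kn; rewrite -[k]/(val (Ordinal kn)) resnE eig.
move=> i; have [|k kS] := St (tab i); first by apply/tabP; exists i.
by exists (val k); rewrite resnE; apply/mapP; exists (val k, laurent_residue (tab i k)).
Qed.

(** Proved over the fraction field, where the tableau basis lives, but stated through identities
    between entries in A, so that theta can be applied. *)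
Lemma form_linprod_rank1 t0 (c : nat -> A) : standard_tableau lambda t0 ->
    (forall k : 'I_n, c k = laurent_residue (t0 k)) ->
    (forall t, standard_tableau lambda t -> t <> t0 ->
       exists k : 'I_n, (val k, laurent_residue (t k)) \in S) ->
  let Z := linprod laurent_jm S in
  [/\ forall i j k m, Z i j * Z k m = Z i m * Z k j,
      \tr Z = scalprod c S
    & forall k, (k < n)%N -> Z *m laurent_jm k = c k *: Z].
Proof.
move=> st0 cE St Z; have [P [tab [Pu tabI tabP eig]]] := form_eigen.
have [i0 ti0] := (tabP t0).1 st0.
have eig' i k : (k < n)%N -> row i P *m map_mx iota (laurent_jm k) =
    iota (resn (tab i) k) *: row i P.
  by move=> kn; rewrite -[k]/(val (Ordinal kn)) resnE eig.
have ZE : map_mx iota Z =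
    scalprod (fun k => iota (resn t0 k)) iS *: (col i0 (invmx P) *m row i0 P).
  rewrite linprod_map -{1}ti0.
  apply: (linprod_rank1 (r := fun i k => iota (resn (tab i) k)) Pu eig') => // i ii0.
  have [||k kS] := St (tab i); first by apply/tabP; exists i.
    by move=> E; case/eqP: ii0; apply: tabI; rewrite E.
  by exists (val k); rewrite resnE; apply/mapP; exists (val k, laurent_residue (tab i k)).
have Zij i j : iota (Z i j) =
    scalprod (fun k => iota (resn t0 k)) iS * (invmx P i i0 * P i0 j).
  by have /matrixP/(_ i j) := ZE; rewrite !mxE big_ord1 !mxE.
have scE : scalprod (fun k => iota (resn t0 k)) iS = iota (scalprod c S).
  rewrite /scalprod big_map rmorph_prod; apply: eq_big_seq => p /Sn pn.
  by rewrite rmorphB -[p.1]/(val (Ordinal pn)) resnE cE.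
split.
- by move=> i j k m; apply: val_inj; rewrite !rmorphM !Zij; ring.
- apply: val_inj; rewrite -scE -[LHS]/(iota _) -trace_map_mx ZE mxtraceZ.
  rewrite mxtrace_mulC trace_mx11 colE mulmxA -row_mul mulmxV // -colE !mxE eqxx.
  exact: mulr1.
move=> k kn; apply: map_val_inj; rewrite map_mxM map_mxZ ZE -scalemxAl -mulmxA.
rewrite eig' // ti0 -[k]/(val (Ordinal kn)) resnE cE -scalemxAr scalerA mulrC.
by rewrite -scalerA.
Qed.

End Module.
End Specialization.

(** * The unique standard tableau of a column *)

Lemma increasing_ord_id n (f : 'I_n -> nat) :
  injective f -> (forall k, f k < n)%N -> (forall k m, f k < f m -> k < m)%N ->
  forall k, f k = k.
Proof.
move=> fI fn fm; pose g k : 'I_n := Ordinal (fn k).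
have gI : injective g by move=> k m /(congr1 val) /fI.
have [h _ gK] := injF_bij gI.
suff H m : forall k : 'I_n, k = m :> nat -> f k = k by move=> k; apply: H erefl.
elim/ltn_ind: m => m IH k km.
have := gK k; set j := h k => /(congr1 val) /= fj.
case: (ltngtP (f k) k) => // [fkk|kfk].
  have E : f (Ordinal (fn k)) = f k by apply: IH erefl; rewrite -km.
  by move: fkk; rewrite -[X in (X < _)%N]/(val (Ordinal (fn k))) (fI _ _ E) ltnn.
have jk : (j < k)%N by apply: fm; rewrite fj.
have : f j = j by apply: IH erefl; rewrite -km.
by rewrite fj => E; rewrite -E ltnn in jk.
Qed.

Section Column.
Variables (l n : nat) (a0 : 'I_l).
Local Notation column := (single (nseq n 1%N) a0).

Lemma in_column x : in_diagram column x = ((x.1.1 < n) && (x.1.2 == 0))%N && (x.2 == a0).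
Proof.
case: x => [[a b] c] /=; rewrite /in_diagram ffunE.
case: (eqVneq c a0) => _; last by rewrite nth_nil andbF.
by rewrite nth_nseq andbT; case: (ltnP a n) => _; [case: b | rewrite ltn0].
Qed.

Definition column_tableau : {ffun 'I_n -> node l} := [ffun k : 'I_n => (val k, 0%N, a0)].

Lemma column_tableau_standard : standard_tableau column column_tableau.
Proof.
split.
- by move=> k m; rewrite !ffunE => -[/val_inj].
- move=> [[a b] c]; rewrite in_column /=; split.
    move=> /andP[/andP[an /eqP->] /eqP->].
    by exists (Ordinal an); rewrite ffunE.
  by case=> k; rewrite ffunE => -[<- <- <-]; rewrite ltn_ord !eqxx.
- by move=> k m a b b' c; rewrite !ffunE => -[_ <- _] -[_ <- _].
by move=> k m a a' b c; rewrite !ffunE => -[<- _ _] -[<- _ _].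
Qed.

Lemma column_tableau_uniq t : standard_tableau column t -> t = column_tableau.
Proof.
move=> [tI tP _ tC].
have tE k : t k = ((t k).1.1, 0%N, a0) /\ ((t k).1.1 < n)%N.
  have := (tP (t k)).2 (ex_intro _ k erefl); rewrite in_column.
  by case: (t k) => [[a b] c] /= /andP[/andP[-> /eqP->] /eqP->].
apply/ffunP => k; rewrite ffunE (tE k).1; congr (_, _, _).
apply: (@increasing_ord_id _ (fun k => (t k).1.1)) => [i j E|i|i j ij].
- by apply: tI; rewrite (tE i).1 (tE j).1 E.
- exact: (tE i).2.
exact: tC (tE i).1 (tE j).1 ij.
Qed.

End Column.

(** * The specialized sign module and its multiplicities *)

Section SpecializedMultiplicities.
Variables (F : fieldType) (l : nat) (eta : F) (s : 'I_l -> int).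
Variable theta : {rmorphism laurent l F -> F}.
Hypothesis theta_spec : is_specialization eta s theta.
Hypothesis eta0 : eta != 0.
Hypothesis eta1 : eta != 1.
Variables (n : nat) (a0 : 'I_l).
Hypothesis n0 : (0 < n)%N.
Local Notation A := (laurent l F).
Local Notation wt := (node_weight s).

Definition sign_weight (k : nat) : F := eta ^ (s a0 - k%:Z).
Local Notation c := sign_weight.

Lemma sign_weightS k : c k = theta (laurent_q l F) * c k.+1.
Proof.
rewrite (theta_q theta_spec) /c -[X in X * _]expr1z -expfzDr //; congr (_ ^ _).
by rewrite -[k.+1]addn1 PoszD; ring.
Qed.

Lemma sign_weight_neq0 k : c k != 0.
Proof. exact: expfz_neq0. Qed.

Lemma sign_weight_neq k : c k != c k.+1.
Proof.
rewrite sign_weightS (theta_q theta_spec) -{2}[c k.+1]mul1r.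
by rewrite (inj_eq (mulIf (sign_weight_neq0 _))).
Qed.

Lemma theta_q_neq0 : theta (laurent_q l F) != 0.
Proof. by rewrite (theta_q theta_spec). Qed.

Section Sign.
Variable M : AKmodule (laurent_q l F) (@laurent_Q l F) n.
Hypothesis formM : is_form (single (nseq n 1%N) a0) M.
Local Notation N := (base_change theta M).

Lemma sign_dim : AKdim N = 1%N.
Proof.
rewrite /=; have [P [tab [_ tabI tabP _]]] := form_eigen formM.
have tabE i : tab i = column_tableau n a0.
  by apply: column_tableau_uniq; apply/tabP; exists i.
have [i0 _] := (tabP _).1 (column_tableau_standard n a0).
apply/eqP; rewrite eqn_leq (leq_ltn_trans _ (ltn_ord i0)) // andbT.
rewrite -[X in (X <= _)%N]card_ord; apply/card_le1P => i _ j.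
rewrite !inE; apply/esym/eqP/tabI; by rewrite !tabE.
Qed.

Lemma sign_jm_scalar k : (k < n)%N -> jucys_murphy N k = (c k)%:M.
Proof.
move=> kn; pose x := laurent_residue F (column_tableau n a0 (Ordinal kn)).
have : linprod (laurent_jm M) [:: (k, x)] = 0.
  apply: (form_linprod_eq0 formM) => [p|t /column_tableau_uniq ->].
    by rewrite inE => /eqP->.
  by exists (Ordinal kn); rewrite inE.
rewrite /= mulmx1 => /eqP; rewrite subr_eq0 => /eqP E.
rewrite -(theta_jm theta_spec eta0) E map_scalar_mx (theta_residue theta_spec eta0).
by rewrite ffunE /= /c addr0.
Qed.

Lemma sign_T0 : AKact N 0%N = (c 0%N)%:M.
Proof. exact: (sign_jm_scalar n0). Qed.

(** In rank one T_j is a scalar t. The recursion for the Jucys-Murphy elements gives t^2 = 1 and the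
    quadratic relation gives t = eta or t = -1; since eta is not 1, t = -1 in either case. *)
Lemma sign_T j : (0 < j < n)%N -> AKact N j = (-1)%:M.
Proof.
case: j => // j jn; have jn' : (j.+1 < n)%N by [].

have Lj := sign_jm_scalar (ltnW jn'); have := sign_jm_scalar jn'.
have := AK_quadratic N (i := j.+1) jn.
rewrite [jucys_murphy N j.+1]jmS Lj.
move: (AKact N j.+1); rewrite sign_dim => t.
have -> : t = (t 0 0)%:M by apply/rowP => i; rewrite (ord1 i) [RHS]mxE eqxx mulr1n.
rewrite -!scalar_mxM !scale_scalar_mx -raddfD /=.
move=> /matrixP/(_ 0 0); rewrite !mxE !eqxx !mulr1n => q1.
move=> /matrixP/(_ 0 0); rewrite !mxE !eqxx !mulr1n => q2.
congr (_%:M); have q0 := theta_q_neq0; have c0 := sign_weight_neq0 j.+1.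
have tt : t 0 0 * t 0 0 = 1.
  apply: (mulIf c0); rewrite mul1r -[RHS]q2 (sign_weightS j).
  by field.
have : (t 0 0 - theta (laurent_q l F)) * (t 0 0 + 1) = 0 by rewrite mulrBl !mulrDr q1; ring.
move/eqP; rewrite mulf_eq0 subr_eq0 addr_eq0 => /orP[/eqP t1|/eqP//].
have : (t 0 0 - 1) * (t 0 0 + 1) = 0 by rewrite mulrBl !mulrDr tt; ring.
move/eqP; rewrite mulf_eq0 subr_eq0 addr_eq0 t1 (theta_q theta_spec) (negbTE eta1) /=.
by move/eqP.
Qed.

End Sign.

Section Multiplicity.
Variables M V : AKmodule (laurent_q l F) (@laurent_Q l F) n.
Variable lambda : mpart l.
Hypothesis formM : is_form (single (nseq n 1%N) a0) M.
Hypothesis formV : is_form lambda V.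
Local Notation N := (base_change theta M).
Local Notation W := (base_change theta V).

(** The factors are L_k - rho for all k in D and all residues rho at position k of some tableau
    whose specialization differs from z_k. The product kills each tableau that leaves the weight z
    on D, and its specialization is a nonzero scalar on the weight z. *)
Lemma separating_products (D : pred nat) (z : nat -> F) :
  exists S : seq (nat * A),
  [/\ forall p, p \in S -> (p.1 < n)%N /\ D p.1,
      scalprod z [seq (p.1, theta p.2) | p <- S] != 0
    & forall t (k : 'I_n), standard_tableau lambda t -> D k ->
        eta ^ wt (t k) != z k -> (val k, laurent_residue F (t k)) \in S].
Proof.
have [P [tab [_ _ tabP _]]] := form_eigen formV.
pose S0 := [seq (val k, laurent_residue F (tab i k)) | i <- enum 'I_(AKdim V), k <- enum 'I_n].
exists [seq p <- S0 | D p.1 && (theta p.2 != z p.1)]; split.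
- move=> p; rewrite mem_filter => /andP[/andP[Dp _] /allpairsP[[i k] [_ _ pE]]].
  by split=> //; rewrite pE /=.
- rewrite /scalprod big_map prodf_seq_neq0; apply/allP => p /=.
  by rewrite mem_filter subr_eq0 eq_sym => /andP[/andP[]].
move=> t k /tabP[i <-] Dk tk; rewrite mem_filter /= Dk (theta_residue theta_spec eta0) tk.
by apply/allpairsP; exists (i, k); rewrite !mem_enum.
Qed.

Let theta_linprod (S : seq (nat * A)) :
  map_mx theta (linprod (laurent_jm V) S) =
  linprod (jucys_murphy W) [seq (p.1, theta p.2) | p <- S].
Proof.
rewrite linprod_map; elim: S => //= p S ->.
by rewrite (theta_jm theta_spec eta0).
Qed.

Lemma sign_comp_mult_neq0 : comp_mult W N <> 0%N ->
  exists t, standard_tableau lambda t /\ forall k : 'I_n, eta ^ wt (t k) = c k.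
Proof.
move=> WN; apply: contrapT => noT.
have [S [SD Sc St]] := separating_products xpredT c.
have S0 : linprod (laurent_jm V) S = 0.
  apply: (form_linprod_eq0 formV) => [p /SD[]//|t st].
  have [k tk|tc] := pickP (fun k : 'I_n => eta ^ wt (t k) != c k).
    by exists k; apply: St.
  by case: noT; exists t; split=> // k; apply/eqP/negbFE/tc.
case/eqP: Sc; apply: (comp_mult_neq0_scalprod theta_q_neq0 n0 _ (sign_T0 formM)) WN _ _.
- by move=> k _; apply: sign_weightS.
- exact: sign_T formM.
- exact: sign_dim formM.
- by move=> p /mapP[p' /SD[pn _] ->].
by rewrite -theta_linprod S0 map_mx0.
Qed.

Lemma sign_comp_mult_eq1 t0 : standard_tableau lambda t0 ->
    (forall k : 'I_n, eta ^ wt (t0 k) = c k) ->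
    (forall t, standard_tableau lambda t ->
       (forall k : 'I_n, eta ^ wt (t k) = c k) -> t = t0) ->
    (forall t (m m' : 'I_n), standard_tableau lambda t -> m' = m.+1 :> nat ->
       (forall k : 'I_n, (k <= m)%N -> eta ^ wt (t k) = c k) ->
       eta ^ wt (t m') <> c m) ->
  comp_mult W N = 1%N.
Proof.
move=> st0 t0c t0_uniq norep.
have [S [SD Sc St]] := separating_products xpredT c.
pose cA k : A := if insub k is Some k' then laurent_residue F (t0 k') else 0.
have cAE (k : 'I_n) : cA k = laurent_residue F (t0 k) by rewrite /cA valK.
have thcA k : (k < n)%N -> theta (cA k) = c k.
  move=> kn; rewrite -[k]/(val (Ordinal kn)) cAE.
  by rewrite (theta_residue theta_spec eta0) t0c.
have [p||minors trZ Zjm] := form_linprod_rank1 (S := S) formV _ st0 cAE.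
- by move=> /SD[].
- move=> t st tt0; have [k tk|tc] := pickP (fun k : 'I_n => eta ^ wt (t k) != c k).
    by exists k; apply: St.
  by case: tt0; apply: t0_uniq => // k; apply/eqP/negbFE/tc.
set Z := linprod _ S in minors trZ Zjm.
have scE : theta (scalprod cA S) = scalprod c [seq (p.1, theta p.2) | p <- S].
  rewrite /scalprod big_map rmorph_prod; apply: eq_big_seq => p /SD[pn _].
  by rewrite rmorphB thcA.
have [||x [i [Zx xi]]] := @rank1_factor _ _ (map_mx theta Z).
- by move=> i j k m; rewrite !mxE -!rmorphM minors.
- by rewrite trace_map_mx trZ scE.
have sn p : p \in [seq (p.1, theta p.2) | p <- S] -> (p.1 < n)%N.
  by case/mapP => p' /SD[pn _] ->.
rewrite theta_linprod in Zx.
apply: (@comp_mult_eq1 _ _ _ _ _ W N theta_q_neq0 c n0 _ _ (sign_dim formM)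
  (sign_T0 formM) _ _ _ _ sn Zx).
- by move=> k _; apply: sign_weightS.
- by move=> k _; apply: sign_weight_neq.
- exact: sign_T formM.
- by rewrite -theta_linprod xi trace_map_mx trZ scE.
- exact: Sc.
- move=> k kn; rewrite -theta_linprod -row_mul -(theta_jm theta_spec eta0) -map_mxM Zjm //.
  by rewrite map_mxZ thcA // linearZ.
move=> j Y y jn sY yc yj.
(* The forbidden weight with c_j repeated. No tableau begins with it, so the product separating it
   is zero; modulo Y it also multiplies y by a nonzero scalar. *)
pose z k := if k == j.+1 then c j else c k.
have [S' [SD' Sc' St']] := separating_products (fun k => k <= j.+1)%N z.
have S0 : linprod (laurent_jm V) S' = 0.
  apply: (form_linprod_eq0 formV) => [p /SD'[]//|t st].
  have [k /andP[kj tk]|tc] := pickP (fun k : 'I_n => (k <= j.+1)%N && (eta ^ wt (t k) != z k)).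
    by exists k; apply: St'.
  have zt (k : 'I_n) : (k <= j.+1)%N -> eta ^ wt (t k) = z k.
    by move=> kj; have := tc k; rewrite kj => /negbFE/eqP.
  case: (norep t (Ordinal (ltnW jn)) (Ordinal jn) st erefl) => [k /= kj|].
    by rewrite (zt _ (leqW kj)) /z ltn_eqF.
  by rewrite (zt (Ordinal jn) (leqnn _)) /z eqxx.
pose S'' := [seq (p.1, theta p.2) | p <- S'].
have : (y *m linprod (jucys_murphy W) S'' - scalprod z S'' *: y <= Y)%MS.
  apply: linprod_mod => p /mapP[p' /SD'[pn pj] ->] /=.
    exact: (submodule_jm sY pn).
  rewrite /z; case: eqP => [->//|pj1]; apply: yc.
  by move: pj => /=; rewrite leq_eqVlt => /orP[/eqP//|].
rewrite -theta_linprod S0 map_mx0 mulmx0 sub0r eqmx_opp.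
by rewrite eqmx_scale.
Qed.

End Multiplicity.

End SpecializedMultiplicities.

(** * The greedy tableau *)

Lemma dvdz_pos_ge (e : nat) (x : int) : (e%:Z %| x)%Z -> 0 < x -> e%:Z <= x.
Proof. by case: x => // m; rewrite dvdzE => /dvdn_leq H m0; apply: H. Qed.

Lemma subr_eq_extremal (R : realFieldType) (x y z w : R) :
  x <= y -> w <= z -> x - z = y - w -> x = y /\ w = z.
Proof. by move=> *; split; lra. Qed.

Lemma ltrB_shift (R : realFieldType) (x y z w k : R) :
  x <= y - k -> w < z + k -> x - z < y - w.
Proof. by move=> *; lra. Qed.

Lemma dvdz_sum (d x y z : int) : (d %| x)%Z -> (d %| y)%Z -> z = x + y -> (d %| z)%Z.
Proof. by move=> dx dy ->; rewrite rpredD. Qed.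

Lemma dvdz_diff (d x y z : int) : (d %| x)%Z -> (d %| y)%Z -> z = x - y -> (d %| z)%Z.
Proof. by move=> dx dy ->; rewrite rpredB. Qed.

Section Greedy.
Variables (l e : nat) (s : 'I_l -> int) (t : nat) (a : 'I_t.+1 -> 'I_l).
Hypothesis he : (2 <= e)%N.
Local Notation sa j := (s (a j)).
Hypothesis max_class : forall c j, (e%:Z %| s c - sa j)%Z -> s c <= sa j.
Hypothesis min_index : forall c j, (e%:Z %| s c - sa j)%Z -> (c < a j)%N -> s c < sa j.
Hypothesis class_cover : forall c, exists j, (e%:Z %| s c - sa j)%Z.
Hypothesis a_lt : forall i j : 'I_t.+1, (i < j)%N -> (a i < a j)%N.
Hypothesis sa_gt : forall i j : 'I_t.+1, (i < j)%N -> sa j < sa i.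
Hypothesis class_inj : forall i j, (e%:Z %| sa i - sa j)%Z -> i = j.

(** Going down from the residue of class i, x is the number of steps until some class before i is
    met, and j is that class. *)
Definition is_next (i j : 'I_t.+1) (x : nat) : Prop :=
  [/\ (j < i)%N, (1 <= x <= e - 1)%N, (e%:Z %| sa i - sa j - x%:Z)%Z
    & forall (j' : 'I_t.+1) (x' : nat), (j' < i)%N -> (1 <= x' <= e - 1)%N ->
        (e%:Z %| sa i - sa j' - x'%:Z)%Z -> (x <= x')%N].

(** [f T] is the node added at step T, counted from 0. In component [a ord0] columns have height e -
    1, since after e - 1 steps down the residue is that of the top of the next column. *)
Inductive greedy : 'I_t.+1 -> (nat -> node l) -> Prop :=
| greedy_first : greedy ord0 (fun T => (T %% (e - 1), T %/ (e - 1), a ord0)%N)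
| greedy_later i j x f : is_next i j x -> greedy j f ->
    greedy i (fun T => if (T < x)%N then (T, 0%N, a i) else f (T - x)%N).

Lemma residue_dist (i j : 'I_t.+1) : i != j ->
  exists2 x : nat, (1 <= x <= e - 1)%N & (e%:Z %| sa i - sa j - x%:Z)%Z.
Proof.
move=> ij; have e0 : e%:Z != 0 by lia.
have m0 := modz_ge0 (sa i - sa j) e0; have me := ltz_mod (sa i - sa j) e0.
have mE : sa i - sa j - ((sa i - sa j) %% e%:Z)%Z = ((sa i - sa j) %/ e%:Z)%Z * e%:Z.
  by rewrite {1}(divz_eq (sa i - sa j) e%:Z) addrK.
case E : ((sa i - sa j) %% e%:Z)%Z m0 me mE => [x|//] _ xe mE.
have xP : (e%:Z %| sa i - sa j - x%:Z)%Z by rewrite mE dvdz_mull.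
exists x => //; case: x xe {E mE} xP => [_ xP|x xe _]; last by lia.
by case/eqP: ij; apply: class_inj; rewrite -[_ - sa j]subr0.
Qed.

Lemma next_exists (i : 'I_t.+1) : (0 < i)%N -> exists j x, is_next i j x.
Proof.
move=> i0; pose P x := (1 <= x <= e - 1)%N &&
  [exists j : 'I_t.+1, (j < i)%N && (e%:Z %| sa i - sa j - x%:Z)%Z].
have [x xe xP] : exists2 x : nat, (1 <= x <= e - 1)%N & (e%:Z %| sa i - sa ord0 - x%:Z)%Z.
  by apply: residue_dist; apply: contraL i0 => /eqP->.
have exP : exists x, P x.
  by exists x; rewrite /P xe; apply/existsP; exists ord0; rewrite i0.
case: (ex_minnP exP) => y /andP[ye /existsP[j /andP[ji yP]]] ymin.
exists j, y; split=> // j' x' j'i x'e x'P; apply: ymin.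
by rewrite /P x'e; apply/existsP; exists j'; rewrite j'i.
Qed.

Lemma next_hit i j x (j' : 'I_t.+1) (T : nat) : is_next i j x -> (T < x)%N ->
  (e%:Z %| sa i - sa j' - T%:Z)%Z -> (i <= j')%N.
Proof.
move=> [_ /andP[_ xe] _ xmin] Tx hit; rewrite leqNgt; apply/negP => j'i.
case: T Tx hit => [_|T Tx hit].
  by rewrite subr0 => /class_inj E; rewrite E ltnn in j'i.
by have := xmin j' T.+1 j'i _ hit; lia.
Qed.

(* The T-th node lies in the column-filling phase of the component a j, which *)
(* starts at time tau; j is minimal among the classes met up to time T.       *)
Lemma greedy_phase i f T : greedy i f ->
  exists (j : 'I_t.+1) (tau y : nat),
  [/\ T = (tau + y)%N, f T = (y %% (e - 1), y %/ (e - 1), a j)%N,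
      (e%:Z %| sa i - sa j - tau%:Z)%Z,
      forall (T0 : nat) (j' : 'I_t.+1), (T0 <= T)%N ->
        (e%:Z %| sa i - sa j' - T0%:Z)%Z -> (j <= j')%N
    & j = ord0 -> forall T0 : nat, (T0 < tau)%N ->
        ~~ (e%:Z %| sa i - sa ord0 - T0%:Z)%Z].
Proof.
move=> G; elim: G T => {i f} [|i j x f nx _ IH] T.
  by exists ord0, 0%N, T; split; rewrite // subrr.
have [ji xe xP xmin] := nx.
case: ltnP => Tx.
  exists i, 0%N, T; split=> //.
  - by rewrite modn_small ?divn_small //; lia.
  - by rewrite subrr.
  by move=> T0 j' T0T; apply: next_hit nx _; lia.
have [j1 [tau [y [TE fE P1 P2 P4]]]] := IH (T - x)%N.
have j1j : (j1 <= j)%N by apply: (P2 0%N); rewrite // subrr.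
exists j1, (x + tau)%N, y; split=> //.
- by lia.
- by apply: (dvdz_sum xP P1); lia.
- move=> T0 j' T0T hit; have [T0x|xT0] := ltnP T0 x.
    by have := next_hit nx T0x hit; lia.
  apply: (P2 (T0 - x)%N); first by lia.
  by apply: (dvdz_diff hit xP); lia.
move=> j10 T0 T0t; apply/negP => hit; have [T0x|xT0] := ltnP T0 x.
  by have := next_hit nx T0x hit; rewrite /=; lia.
have lt_tau : (T0 - x < tau)%N by lia.
case/negP: (P4 j10 _ lt_tau).
by apply: (dvdz_diff hit xP); lia.
Qed.

Local Notation wt := (node_weight s).

Lemma greedy_range i f T : greedy i f -> exists2 j : 'I_t.+1, (j <= i)%N & (f T).2 = a j.
Proof.
move=> G; have [j [tau [y [_ fE _ P2 _]]]] := greedy_phase T G.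
by exists j; [apply: (P2 0%N); rewrite // !subrr | rewrite fE].
Qed.

Lemma a_inj : injective a.
Proof.
move=> i j aij; apply: val_inj; case: (ltngtP i j) => // /a_lt.
  by rewrite aij ltnn.
by rewrite aij ltnn.
Qed.

(** Any class is at distance at most e - 1 from class 0, so by time e - 1 the last phase, in
    component [a ord0], has begun. *)
Lemma greedy_early i f T : greedy i f -> (e - 1 <= T)%N ->
  exists tau y : nat, [/\ T = (tau + y)%N, (tau <= e - 1)%N
    & f T = (y %% (e - 1), y %/ (e - 1), a ord0)%N].
Proof.
move=> G eT; have [j [tau [y [TE fE _ P2 P4]]]] := greedy_phase T G.
suff [D De hit] : exists2 D : nat, (D <= e - 1)%N & (e%:Z %| sa i - sa ord0 - D%:Z)%Z.
  have j0 : j = ord0 by apply/val_inj/eqP; rewrite -leqn0; apply: P2 hit; lia.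
  exists tau, y; split=> //; last by rewrite fE j0.
  by rewrite leqNgt; apply/negP => tD; case/negP: (P4 j0 D ltac:(lia)).
have [->|/residue_dist[D De hit]] := eqVneq i ord0; first by exists 0%N; rewrite // subrr.
by exists D; [lia|].
Qed.

(** In a phase y = b (e - 1) + r, hence b - r = b e - y: modulo e the residue drops by one at every
    step. *)
Lemma greedy_weight i f T : greedy i f -> (e%:Z %| wt (f T) - (sa i - T%:Z))%Z.
Proof.
move=> G; have [j [tau [y [TE fE P1 _ _]]]] := greedy_phase T G.
have yE := divn_eq y (e - 1); set b := (y %/ _)%N in yE; set r := (y %% _)%N in yE.
have -> : wt (f T) - (sa i - T%:Z) = b%:Z * e%:Z - (sa i - sa j - tau%:Z).
  have yZ : y%:Z = b%:Z * e%:Z - b%:Z + r%:Z by nia.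
  by rewrite fE /wt -/b -/r TE PoszD yZ; ring.
by rewrite rpredB // dvdz_mull.
Qed.

Lemma greedy_up i f T m b c : greedy i f -> f T = (m.+1, b, c) ->
  (0 < T)%N /\ f T.-1 = (m, b, c).
Proof.
move=> G; elim: G T => {i f} [|i j x f nx _ IH] T.
  case=> TE <- <-; have T0 : (0 < T)%N by case: T TE => //; rewrite mod0n.
  have TE2 := divn_eq T (e - 1); rewrite TE in TE2.
  have mlt : (m.+1 < e - 1)%N by rewrite -TE ltn_mod; lia.
  have e0 : (0 < e - 1)%N by lia.
  have -> : T.-1 = (T %/ (e - 1) * (e - 1) + m)%N by rewrite {1}TE2 addnS.
  have mlt' := ltnW mlt.
  by rewrite modnMDl divnMDl // (modn_small mlt') (divn_small mlt') addn0.
case: ltnP => Tx; first by case=> TE <- <-; rewrite TE in Tx *; rewrite /= (ltnW Tx).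
case/IH => T0 fT; have xT : (x <= T.-1)%N by lia.
have E : (T.-1 - x = (T - x).-1)%N by lia.
split; first by lia.
by rewrite ltnNge xT /= E.
Qed.

Lemma greedy_left i f T m b c : greedy i f -> f T = (m, b.+1, c) ->
  (e - 1 <= T)%N /\ f (T - (e - 1))%N = (m, b, c).
Proof.
move=> G; elim: G T => {i f} [|i j x f nx _ IH] T.
  case=> <- TE <-; have TE2 := divn_eq T (e - 1); rewrite TE in TE2.
  split; first by rewrite TE2; lia.
  have -> : (T - (e - 1) = b * (e - 1) + T %% (e - 1))%N.
    by rewrite {1}TE2 mulSn; lia.
  have rlt : (T %% (e - 1) < e - 1)%N by rewrite ltn_mod; lia.
  by rewrite modnMDl divnMDl ?modn_mod ?(divn_small rlt) ?addn0 //; lia.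
case: ltnP => // Tx.
case/IH => T0 fT; have xT : (x <= T - (e - 1))%N by lia.
have E : (T - (e - 1) - x = T - x - (e - 1))%N by lia.
split; first by lia.
by rewrite ltnNge xT /= E.
Qed.

Lemma greedy_inj i f : greedy i f -> injective f.
Proof.
move=> G; elim: G => {i f} [T T' [Tm Td]|i j x f nx G fI T T'].
  by rewrite (divn_eq T (e - 1)) (divn_eq T' (e - 1)) Tm Td.
have [ji _ _ _] := nx.
have neq U : a i <> (f U).2.
  have [j' j'j ->] := greedy_range U G => /a_inj E.
  by move: ji j'j; rewrite E; lia.
case: ltnP => Tx; case: ltnP => T'x.
- by case.
- by move=> E; case: (neq (T' - x)%N); rewrite -E.
- by move=> E; case: (neq (T - x)%N); rewrite E.
by move/fI; lia.
Qed.

Lemma greedy_up_iter i f T d m b c : greedy i f -> f T = ((m + d)%N, b, c) ->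
  exists2 T', f T' = (m, b, c) & (T' + d = T)%N.
Proof.
move=> G; elim: d T => [|d IH] T; first by rewrite addn0 => fT; exists T; rewrite ?addn0.
rewrite addnS => /(greedy_up G)[T0 /IH[T' fT' E]]; exists T' => //; lia.
Qed.

Lemma greedy_left_iter i f T d m b c : greedy i f -> f T = (m, (b + d)%N, c) ->
  exists2 T', f T' = (m, b, c) & (T' + d <= T)%N.
Proof.
move=> G; elim: d T => [|d IH] T; first by rewrite addn0 => fT; exists T; rewrite ?addn0.
rewrite addnS => /(greedy_left G)[T0 /IH[T' fT' E]]; exists T' => //; lia.
Qed.

Definition greedy_shape n (f : nat -> node l) (lambda : mpart l) : Prop :=
  is_mpart n lambda /\
  forall x, in_diagram lambda x <-> exists2 T, (T < n)%N & f T = x.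

Definition greedy_tableau n (f : nat -> node l) : {ffun 'I_n -> node l} :=
  [ffun k : 'I_n => f k].

Lemma greedy_standard i f n lambda : greedy i f -> greedy_shape n f lambda ->
  standard_tableau lambda (greedy_tableau n f).
Proof.
move=> G [_ shp]; split.
- by move=> k m; rewrite !ffunE => /(greedy_inj G)/val_inj.
- move=> x; rewrite shp; split=> [[T Tn <-]|[k <-]]; last by exists k; rewrite ?ffunE.
  by exists (Ordinal Tn); rewrite ffunE.
- move=> k m r b b' c; rewrite !ffunE => fk fm bb'.
  have := fm; rewrite -(subnKC (ltnW bb')) => /(greedy_left_iter G)[T' fT' TE].
  by have := greedy_inj G (etrans fT' (esym fk)); lia.
move=> k m r r' b c; rewrite !ffunE => fk fm rr'.
have := fm; rewrite -(subnKC (ltnW rr')) => /(greedy_up_iter G)[T' fT' TE].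
by have := greedy_inj G (etrans fT' (esym fk)); lia.
Qed.

(** At time T >= e the last phase is past its corner, so the new node has a left or upper neighbour,
    added 1 or e - 1 steps earlier. *)
Lemma greedy_neighbour i f T : greedy i f -> (e <= T)%N ->
  exists T', [/\ (T - (e - 1) <= T')%N, (T' < T)%N &
    (exists m b c, f T = (m, b.+1, c) /\ f T' = (m, b, c)) \/
    (exists m b c, f T = (m.+1, b, c) /\ f T' = (m, b, c))].
Proof.
move=> G eT; have eT' : (e - 1 <= T)%N by lia.
have [tau [y [TE taue fE]]] := greedy_early G eT'.
case db : (y %/ (e - 1))%N => [|b].
  case rm : (y %% (e - 1))%N => [|m].
    by have := divn_eq y (e - 1); rewrite db rm; lia.
  have fT : f T = (m.+1, 0%N, a ord0) by rewrite fE db rm.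
  have [T0 fT'] := greedy_up G fT.
  by exists T.-1; split; [lia | lia | right; exists m, 0%N, (a ord0)].
have fT : f T = ((y %% (e - 1))%N, b.+1, a ord0) by rewrite fE db.
have [T0 fT'] := greedy_left G fT.
by exists (T - (e - 1))%N; split; [lia | lia | left; do 3 eexists; eauto].
Qed.

Section TableauOfGreedyShape.
Variables (i : 'I_t.+1) (f : nat -> node l) (n : nat) (lambda : mpart l).
Hypothesis G : greedy i f.
Hypothesis shp : greedy_shape n f lambda.
Variable u : {ffun 'I_n -> node l}.
Hypothesis u_std : standard_tableau lambda u.

(** Let [u m = f T], so that T >= m and T = r modulo e. If T > r, then T >= r + e, and
    [greedy_neighbour] gives a node [f T'] with T' >= r + 1 >= m that must precede [f T] in u; but
    before m only the nodes f 0, ..., f (m - 1) occur. The case r = m yields uniqueness, r = m - 1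
    excludes repetitions. *)
Lemma greedy_rigid (m : 'I_n) (r : nat) :
    (r <= m <= r.+1)%N -> (forall k : 'I_n, (k < m)%N -> u k = f k) ->
  (e%:Z %| wt (u m) - (sa i - r%:Z))%Z -> m = r :> nat /\ u m = f m.
Proof.
move=> rm pre wm; have [uI uP uR uC] := u_std.
have [T Tn fT] : exists2 T, (T < n)%N & f T = u m by apply/shp.2/uP; exists m.
have mT : (m <= T)%N.
  rewrite leqNgt; apply/negP => Tm; have := pre (Ordinal Tn) Tm; rewrite /= fT.
  by move/uI/(congr1 val) => /= E; rewrite E ltnn in Tm.
have dT : (e%:Z %| T%:Z - r%:Z)%Z.
  by have := greedy_weight T G; rewrite fT => wT; apply: (dvdz_diff wT wm); ring.
case: (ltnP r T) => [rT|Tr]; last first.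
  by split; [lia | rewrite -fT; congr f; lia].
have rTe : e%:Z <= T%:Z - r%:Z by apply: dvdz_pos_ge => //; lia.
have eT : (e <= T)%N by lia.
have [T' [T'1 T'T nb]] := greedy_neighbour G eT.
have [k uk] : exists k, u k = f T'.
  by apply/uP/shp.2; exists T' => //; apply: ltn_trans T'T Tn.
have km : (k < m)%N.
  case: nb => -[m0 [b [c [E1 E2]]]].
    by apply: (uR k m m0 b b.+1 c); rewrite // ?uk // -fT.
  by apply: (uC k m m0 m0.+1 b c); rewrite // ?uk // -fT.
by have := pre k km; rewrite uk => /(greedy_inj G); lia.
Qed.

End TableauOfGreedyShape.

Lemma greedy_tableau_uniq i f n lambda (u : {ffun 'I_n -> node l}) :
    greedy i f -> greedy_shape n f lambda -> standard_tableau lambda u ->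
    (forall k : 'I_n, (e%:Z %| wt (u k) - (sa i - (k : nat)%:Z))%Z) ->
  u = greedy_tableau n f.
Proof.
move=> G shp su wu; apply/ffunP => k; rewrite ffunE.
suff H m : forall k : 'I_n, k = m :> nat -> u k = f k by apply: H erefl.
elim/ltn_ind: m => m IH {}k km.
have [] // := greedy_rigid G shp su _ _ (wu k); first by rewrite leqnn leqnSn.
by move=> k' k'k; apply: IH erefl; rewrite -km.
Qed.

Lemma greedy_no_repeat i f n lambda (u : {ffun 'I_n -> node l}) (m m' : 'I_n) :
    greedy i f -> greedy_shape n f lambda -> standard_tableau lambda u ->
    m' = m.+1 :> nat ->
    (forall k : 'I_n, (k <= m)%N -> (e%:Z %| wt (u k) - (sa i - (k : nat)%:Z))%Z) ->
  ~~ (e%:Z %| wt (u m') - (sa i - (m : nat)%:Z))%Z.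
Proof.
move=> G shp su m'E wu; apply/negP => wm'.
suff pre : forall k : 'I_n, (k < m')%N -> u k = f k.
  by have [] := greedy_rigid G shp su _ pre wm'; lia.
suff H r : forall k : 'I_n, (k < m')%N -> k = r :> nat -> u k = f k.
  by move=> k km; apply: H erefl.
elim/ltn_ind: r => r IH k km kr.
have [] // := greedy_rigid G shp su _ _ (wu k _); try lia.
by move=> k' k'k; apply: (IH k') => //; lia.
Qed.

(** * Nodewise dominance of the greedy tableau *)

Section Dominance.
Variables (v : 'I_l -> rat) (n : nat) (mu : mpart l) (u : {ffun 'I_n -> node l}).
Hypothesis v_lt : forall c c' : 'I_l, (c < c')%N -> v c < v c'.
Hypothesis v_bound : forall c c' : 'I_l, v c' < v c + e%:R.
Hypothesis mu_part : forall c, is_part (mu c).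
Hypothesis u_std : standard_tableau mu u.
Variables (i : 'I_t.+1) (f : nat -> node l).
Hypothesis G : greedy i f.
Hypothesis u_weight : forall k : 'I_n, (e%:Z %| wt (u k) - (sa i - (k : nat)%:Z))%Z.

(** This is the beta number of a row that ends with the node x. *)
Definition node_content (x : node l) : rat := (wt x)%:~R - v x.2.

Lemma part_nonincr p (r r' : nat) : is_part p -> (r <= r')%N ->
  (nth 0 p r' <= nth 0 p r)%N.
Proof.
move=> /andP[p_sorted _] rr'; have [pr'|r'p] := leqP (size p) r'.
  by rewrite (nth_default _ pr').
apply: (sorted_leq_nth (leT := geq)) => //; rewrite ?inE //.
- by move=> x y z /= xy yz; apply: leq_trans yz xy.
- by move=> x /=.
exact: leq_ltn_trans r'p.
Qed.

(** Along a row the residue rises by 1 per node, along u it drops by 1 per step; so neighbours in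
    the first row are at least e - 1 steps apart. *)
Lemma row_start_time (b : nat) (m : 'I_n) c : u m = (0%N, b, c) ->
  exists2 T0 : 'I_n, u T0 = (0%N, 0%N, c) & (T0 + b * (e - 1) <= m)%N.
Proof.
have [uI uP uR _] := u_std.
elim: b m => [|b IH] m um; first by exists m; rewrite ?mul0n ?addn0.
have [k uk] : exists k, u k = (0%N, b, c).
  by apply/uP; have /uP := ex_intro (fun k => u k = _) m um; rewrite /= => /ltnW.
have km : (k < m)%N by apply: uR uk um _.
have [T0 uT0 T0k] := IH k uk; exists T0 => //.
have em : (e%:Z %| m%:Z - k%:Z + 1)%Z.
  have := u_weight m; have := u_weight k; rewrite uk um /= => wk wm.
  by apply: (dvdz_diff wm wk); lia.
have : e%:Z <= m%:Z - k%:Z + 1 by apply: dvdz_pos_ge => //; lia.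
by rewrite mulSn; lia.
Qed.

(** When u opens component c, its class has been met, so it is not before the current class j of the
    greedy phase and its charge is at most [sa j]. [row_start_time] bounds the column b, and the
    congruence modulo e turns the resulting estimate into an inequality of weights. A component
    before [a j] loses a further e, which outweighs the difference of the v's. *)
Lemma dominated (m : 'I_n) : node_content (u m) <= node_content (f m) /\
  (node_content (u m) = node_content (f m) -> (u m).2 = (f m).2 /\ wt (u m) = wt (f m)).
Proof.
have [uI uP uR uC] := u_std.
have [j [tau [y [TE fE _ P2 P4]]]] := greedy_phase m G.
have wf := greedy_weight m G; have wu := u_weight m.
case um : (u m) => [[r b] c]; rewrite um in wu.
have [m' um' m'm] : exists2 m' : 'I_n, u m' = (0%N, b, c) & (m' <= m)%N.
  case: r um wu => [|r] um _; first by exists m.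
  have /uP[k uk] : in_diagram mu (0%N, b, c).
    have /uP : exists k, u k = (r.+1, b, c) by exists m.
    by move=> /= bm; apply: leq_trans bm (part_nonincr _ _).
  by exists k => //; apply: ltnW; apply: uC uk um _.
have [T0 uT0 T0m] := row_start_time um'.
have [j' cj'] := class_cover c.
have hit : (e%:Z %| sa i - sa j' - (T0 : nat)%:Z)%Z.
  by have := u_weight T0; rewrite uT0 /= => w0; apply: (dvdz_diff cj' w0); lia.
have T0m' : (T0 + b * (e - 1) <= m)%N by apply: leq_trans T0m m'm.
have jj' : (j <= j')%N by apply: P2 hit; apply: leq_trans (leq_addr _ _) T0m'.
have sajj' : sa j' <= sa j.
  move: jj'; rewrite leq_eqVlt => /orP[/eqP/val_inj->//|/sa_gt]; exact: ltW.
have e0 : (0 < e - 1)%N by lia.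
set q := (y %/ (e - 1))%N in fE; set g := (y %% (e - 1))%N in fE.
have ge : (g < e - 1)%N by rewrite ltn_mod.
have yE : y = (q * (e - 1) + g)%N by exact: divn_eq.
have scj := max_class cj'.
have bound : s c + b%:Z <= sa j + q%:Z /\
    ((c < a j)%N -> s c + b%:Z <= sa j + q%:Z - e%:Z).
  have strict : (c < a j)%N -> s c <= sa j' - e%:Z.
    move=> caj; have caj' : (c < a j')%N.
      by move: jj'; rewrite leq_eqVlt => /orP[/eqP/val_inj<-//|/a_lt]; apply: ltn_trans.
    have := min_index cj' caj'; rewrite -subr_gt0 => pos.
    have : e%:Z <= sa j' - s c by apply: dvdz_pos_ge => //; rewrite -opprB rpredN.
    by lia.
  (* If j is not 0, then m < e - 1 and b = 0. If j = 0, then b <= q unless j' was met before the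
     phase began; in that case b <= q + 1, and [sa j' < sa j] makes up for it. *)
  have bq : (sa j' + b%:Z <= sa j + q%:Z).
    have [j0|j0] := eqVneq j ord0; last first.
      have me : (m < e - 1)%N.
        rewrite ltnNge; apply/negP => /(greedy_early G)[tau' [y' [_ _ fE']]].
        by move: j0; rewrite -(inj_eq a_inj); rewrite fE in fE'; case: fE' => _ _ ->; rewrite eqxx.
      have b0 : b = 0%N.
        by case: (b) T0m' => // b'; rewrite mulSn => ?; lia.
      by rewrite b0; lia.
    have [T0tau|tauT0] := ltnP T0 tau; last first.
      have bq : (b <= q)%N by rewrite leq_divRL //; clear -T0m' tauT0 TE; lia.
      by clear -bq sajj'; lia.
    have j'j : j' != j.
      by apply/negP => /eqP E; have := P4 j0 _ T0tau; rewrite -j0 -E hit.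
    have jltj' : (j < j')%N by rewrite ltn_neqAle jj' andbT eq_sym.
    have taue : (tau <= e - 1)%N.
      have [em|me] := leqP (e - 1) m; last by lia.
      have [tau' [y' [mE taue fE']]] := greedy_early G em.
      rewrite fE in fE'; case: fE' => gE qE _.
      have -> : tau = tau' by have := divn_eq y' (e - 1); rewrite -gE -qE -yE; lia.
      by [].
    have : (b <= q.+1)%N.
      rewrite -ltnS -(ltn_pmul2r e0) !mulSn.
      have : (b * (e - 1) <= y + (e - 1))%N.
        by apply: leq_trans (leq_addl T0 _) (leq_trans T0m' _); rewrite TE addnC leq_add2l.
      rewrite yE; move: (b * _)%N (q * _)%N => B C; clear -ge; lia.
    by have := sa_gt jltj'; lia.
  by split=> [|caj]; [lia | have := strict caj; lia].
have wE : wt (f m) = sa j + q%:Z - g%:Z by rewrite fE.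
have uE : wt (r, b, c) = s c + b%:Z - r%:Z by [].
have dv : (e%:Z %| wt (r, b, c) - wt (f m))%Z by apply: (dvdz_diff wu wf); ring.
have [bound1 bound2] := bound.
(* The two weights are congruent modulo e and the first exceeds the second by at most g < e - 1. *)
have le1 : wt (r, b, c) <= wt (f m).
  rewrite leNgt -subr_gt0; apply/negP => /(dvdz_pos_ge dv).
  by move: bound1; rewrite wE uE; clear -ge; lia.
have [caj|ajc] := ltnP c (a j).
  have le2 : wt (r, b, c) <= wt (f m) - e%:Z.
    rewrite leNgt -subr_gt0; apply/negP => pos.
    have : (e%:Z %| wt (r, b, c) - (wt (f m) - e%:Z))%Z.
      by rewrite opprB addrA addrAC rpredD.
    move/dvdz_pos_ge => /(_ pos); move: (bound2 caj); rewrite wE uE.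
    by clear -ge; lia.
  have lt : (wt (r, b, c))%:~R - v c < (wt (f m))%:~R - v (a j).
    apply: ltrB_shift (v_bound c (a j)).
    by rewrite -[e%:R]/(e%:Z%:~R) -rmorphB ler_int.
  rewrite /node_content fE /= in lt *.
  by split; [exact: ltW | move=> E; rewrite E ltxx in lt].
have le1' : (wt (r, b, c))%:~R <= (wt (g, q, a j))%:~R :> rat by rewrite ler_int -fE.
have vle : v (a j) <= v c.
  by move: ajc; rewrite leq_eqVlt => /orP[/eqP/val_inj->//|/v_lt/ltW].
rewrite /node_content fE; split; first exact: lerB.
move=> /(subr_eq_extremal le1' vle)[wE' vE].
split; last exact: (intr_inj wE').
by apply: val_inj; case: (ltngtP c (a j)) => [|/v_lt|//]; [lia | rewrite vE ltxx].
Qed.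

(** At a first disagreement [u k] and [f k] lie on one diagonal. The one further up and left must
    have been added before step k in the tableau containing the other, where u and f still agree;
    injectivity is violated. *)
Lemma dominated_eq : (forall m : 'I_n, (u m).2 = (f m).2 /\ wt (u m) = wt (f m)) ->
  u = greedy_tableau n f.
Proof.
move=> same; apply/ffunP => k; rewrite ffunE; have [uI uP uR uC] := u_std.
suff H m : forall k : 'I_n, k = m :> nat -> u k = f k by apply: H erefl.
elim/ltn_ind: m => m IH {}k km.
have {}IH (k' : 'I_n) : (k' < k)%N -> u k' = f k' by move=> ?; apply: IH erefl; lia.
have := same k; case uk : (u k) => [[r b] c]; case fk : (f k) => [[r' b'] c'] /=.
case=> E W; rewrite -E in fk W *.
case: (ltngtP r r') => [rr'|r'r|rr']; last by congr (_, _, _); lia.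
  have fk' : f k = ((r + (r' - r))%N, (b + (r' - r))%N, c).
    by rewrite fk; congr (_, _, _); lia.
  have [T1 fT1 E1] := greedy_up_iter G fk'.
  have [T2 fT2 E2] := greedy_left_iter G fT1.
  have T2k : (T2 < k)%N by lia.
  have := IH (Ordinal (ltn_trans T2k (ltn_ord k))) T2k; rewrite /= fT2 -uk.
  by move/uI/(congr1 val) => /= ?; lia.
have /uP[k1 uk1] : in_diagram mu (r', b, c).
  have /uP := ex_intro (fun k => u k = _) k uk => /= bm.
  by apply: leq_trans bm (part_nonincr _ (ltnW r'r)).
have /uP[k2 uk2] : in_diagram mu (r', b', c).
  have /uP := ex_intro (fun k => u k = _) k1 uk1 => /= bm.
  by apply: leq_ltn_trans bm; lia.
have k1k : (k1 < k)%N by apply: uC uk1 uk r'r.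
have k2k1 : (k2 < k1)%N by apply: uR uk2 uk1 _; lia.
have k2k := ltn_trans k2k1 k1k.
by have := IH k2 k2k; rewrite uk2 -fk => /(greedy_inj G); lia.
Qed.

End Dominance.

End Greedy.

(** * Partitions and diagrams *)

Section Shapes.
Variable l : nat.
Implicit Types (lambda mu : mpart l) (c : 'I_l).

Lemma nth_add_part p r x : nth 0%N (add_part p r) x = (nth 0 p x + nth 0 r x)%N.
Proof.
have [xm|mx] := ltnP x (maxn (size p) (size r)); first by rewrite nth_mkseq.
by rewrite !nth_default ?size_mkseq //; move: mx; rewrite geq_max => /andP[].
Qed.

Lemma add_part0s p : add_part [::] p = p.
Proof. by rewrite /add_part max0n; under eq_mkseq do rewrite nth_nil add0n; rewrite mkseq_nth. Qed.

Lemma add_parts0 p : add_part p [::] = p.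
Proof. by rewrite /add_part maxn0; under eq_mkseq do rewrite nth_nil addn0; rewrite mkseq_nth. Qed.

Lemma part_eq_nil p : is_part p -> (forall x, nth 0%N p x = 0%N) -> p = [::].
Proof.
case: p => // y p /andP[_ /negP p0] nth0; case: p0.
by rewrite -(nth0 0%N) mem_nth.
Qed.

Lemma part_eq p r : is_part p -> is_part r ->
  (forall x, nth 0%N p x = nth 0%N r x) -> p = r.
Proof.
move=> /andP[_ p0] /andP[_ r0] E; apply: (@eq_from_nth _ 0%N) => [|x _]; last exact: E.
have key (u w : seq nat) : 0%N \notin u -> (forall x, nth 0%N u x = nth 0%N w x) ->
    (size u <= size w)%N.
  move=> u0 Euw; rewrite leqNgt; apply/negP => wu; case/negP: u0.
  by rewrite -(nth_default 0%N (leqnn (size w))) -Euw mem_nth.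
by apply/eqP; rewrite eqn_leq !key // => x; rewrite E.
Qed.

Lemma mpart_eq n mu lambda : is_mpart n mu -> is_mpart n lambda ->
  (forall x, in_diagram mu x <-> in_diagram lambda x) -> mu = lambda.
Proof.
move=> /andP[/forallP muP _] /andP[/forallP laP _] E; apply/ffunP => c.
apply: part_eq => // x; apply/eqP; rewrite eqn_leq; apply/andP; split.
  rewrite leqNgt; apply/negP => H; have := E (x, nth 0%N (lambda c) x, c).
  by rewrite /in_diagram ltnn => -[/(_ H)].
rewrite leqNgt; apply/negP => H; have := E (x, nth 0%N (mu c) x, c).
by rewrite /in_diagram ltnn => -[_ /(_ H)].
Qed.

Lemma is_mpart_single n p c : is_part p -> sumn p = n -> is_mpart n (single p c).
Proof.
move=> pp pn; apply/andP; split.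
  by apply/forallP => c'; rewrite ffunE; case: eqP.
rewrite (bigD1 c) //= ffunE eqxx big1 ?addn0 ?pn // => c' cc'.
by rewrite ffunE (negbTE cc').
Qed.

Lemma column_mpart n c : is_mpart n (single (nseq n 1%N) c).
Proof.
apply: is_mpart_single; last by rewrite sumn_nseq mul1n.
apply/andP; split; last by rewrite mem_nseq andbF.
by elim: n => // -[|n].
Qed.

Lemma in_diagram_single p c x :
  in_diagram (single p c) x = (x.2 == c) && (x.1.2 < nth 0 p x.1.1)%N.
Proof.
by case: x => [[r b] c'] /=; rewrite /in_diagram ffunE; case: eqP => //; rewrite nth_nil.
Qed.

Lemma add_single_mpart n x p lambda c : is_part p -> sumn p = x ->
    lambda c = [::] -> is_mpart n lambda ->
  is_mpart (x + n) (add_mpart (single p c) lambda).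
Proof.
move=> pp px lc /andP[/forallP laP /eqP lan].
have addE c' : add_mpart (single p c) lambda c' = if c' == c then p else lambda c'.
  by rewrite !ffunE; case: eqP => [->|_]; rewrite ?lc ?add_parts0 ?add_part0s.
apply/andP; split; first by apply/forallP => c'; rewrite addE; case: eqP.
have lanE : (\sum_(c' | c' != c) sumn (lambda c') = n)%N.
  by rewrite -lan [RHS](bigD1 c) //= lc.
rewrite (bigD1 c) //= addE eqxx px -[in X in _ == X]lanE eqn_add2l.
by apply/eqP/eq_bigr => c' cc'; rewrite addE (negbTE cc').
Qed.

(** The summands occupy different components, so their sum is the union of the diagrams. *)
Lemma in_diagram_add mu lambda c x : (forall c', c' != c -> mu c' = [::]) ->
    lambda c = [::] ->
  in_diagram (add_mpart mu lambda) x = in_diagram mu x || in_diagram lambda x.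
Proof.
move=> mu0 lc; case: x => [[r b] c']; rewrite /in_diagram ffunE nth_add_part.
by have [->|/mu0->] := eqVneq c' c; rewrite ?lc !nth_nil ?addn0 ?add0n ?orbF.
Qed.

Lemma nth_two_values q r m x : (r <= m)%N ->
  nth 0%N [seq p <- nseq r q.+1 ++ nseq (m - r) q | (0 < p)%N] x =
  if (x < r)%N then q.+1 else if (x < m)%N then q else 0%N.
Proof.
move=> rm; rewrite filter_cat (@eq_in_filter _ _ predT (nseq r _)); last first.
  by move=> y; rewrite mem_nseq => /andP[_ /eqP->].
rewrite filter_predT nth_cat size_nseq nth_nseq; case: ltnP => // rx.
case: q => [|q]; last first.
  rewrite (@eq_in_filter _ _ predT); last by move=> y; rewrite mem_nseq => /andP[_ /eqP->].
  by rewrite filter_predT nth_nseq ltn_subLR // subnKC // leqNgt; case: ltnP => //; lia.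
rewrite (@eq_in_filter _ _ pred0); last by move=> y; rewrite mem_nseq => /andP[_ /eqP->].
by rewrite filter_pred0 nth_nil if_same.
Qed.

Lemma two_values_part q r m : is_part [seq p <- nseq r q.+1 ++ nseq m q | (0 < p)%N].
Proof.
apply/andP; split; last by rewrite mem_filter.
apply: sorted_filter; first by move=> x y z /= xy yz; apply: leq_trans yz xy.
have sorted_q : sorted geq (nseq m q) by case: m => //= m; elim: m => //= m ->; rewrite leqnn.
case: r => //= r; elim: r => [|r IH] /=; last by rewrite leqnn.
by case: m sorted_q => //= m ->; rewrite leqnSn.
Qed.

Lemma sumn_filter_pos (p : seq nat) : sumn [seq x <- p | (0 < x)%N] = sumn p.
Proof. by elim: p => //= -[|x] p IH //=; rewrite IH. Qed.

End Shapes.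

(** * Shapes of the greedy tableaux *)

Section GreedyShapes.
Variables (l e : nat) (s : 'I_l -> int) (t : nat) (a : 'I_t.+1 -> 'I_l).
Hypothesis he : (2 <= e)%N.
Hypothesis a_lt : forall i j : 'I_t.+1, (i < j)%N -> (a i < a j)%N.
Hypothesis class_inj : forall i j, (e%:Z %| s (a i) - s (a j))%Z -> i = j.
Local Notation greedy := (greedy e s a).
Local Notation is_next := (is_next e s a).

Lemma first_shape n q r : n = (q * (e - 1) + r)%N -> (r <= e - 2)%N ->
  greedy_shape n (fun T => (T %% (e - 1), T %/ (e - 1), a ord0)%N)
    (single [seq p <- nseq r q.+1 ++ nseq (e - 1 - r) q | (0 < p)%N] (a ord0)).
Proof.
move=> nE re; have e0 : (0 < e - 1)%N by lia.
split.
  apply: is_mpart_single; first exact: two_values_part.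
  rewrite sumn_filter_pos sumn_cat !sumn_nseq nE.
  have [m E] : exists m, (e - 1 = r + m)%N by exists (e - 1 - r)%N; lia.
  by rewrite E addKn mulSn mulnDr; lia.
move=> [[x b] c]; rewrite in_diagram_single /= nth_two_values; last by lia.
split.
  move=> /andP[/eqP-> bx].
  have xe : (x < e - 1)%N by move: bx; case: (ltnP x r) => xr; [lia | case: (ltnP x (e - 1))].
  exists (b * (e - 1) + x)%N.
    rewrite nE; move: bx; rewrite xe; case: (ltnP x r) => xr bq; nia.
  by rewrite modnMDl divnMDl // (modn_small xe) (divn_small xe) addn0.
move=> [T Tn [<- <- <-]]; rewrite eqxx /= ltn_mod e0.
have := divn_eq T (e - 1); move: (T %/ _)%N (T %% _)%N => b' x' TE.
by case: (ltnP x' r) => xr; nia.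
Qed.


Lemma short_shape i x f n : (n <= x)%N ->
  greedy_shape n (fun T => if (T < x)%N then (T, 0%N, a i) else f (T - x)%N)
    (single (nseq n 1%N) (a i)).
Proof.
move=> nx; split; first exact: column_mpart.
move=> [[r b] c]; rewrite in_column /=; split.
  move=> /andP[/andP[rn /eqP->] /eqP->]; exists r => //.
  by rewrite (leq_trans rn nx).
by case=> T Tn; rewrite (leq_trans Tn nx) => -[<- <- <-]; rewrite Tn !eqxx.
Qed.

(** After time x only components of classes up to j < i are used, so nothing more is added to
    component [a i]. *)
Lemma later_shape i j x f n lambda : is_next i j x -> greedy j f -> (x < n)%N ->
    greedy_shape (n - x) f lambda ->
  greedy_shape n (fun T => if (T < x)%N then (T, 0%N, a i) else f (T - x)%N)
    (add_mpart (single (nseq x 1%N) (a i)) lambda).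
Proof.
move=> nx G xn [la shp]; have [ji _ _ _] := nx.
have la0 : lambda (a i) = [::].
  apply: part_eq_nil => [|y]; first by case/andP: la => /forallP.
  apply/eqP; rewrite -leqn0 leqNgt; apply/negP => pos.
  have /shp[T _ fT] : in_diagram lambda (y, 0%N, a i) by [].
  have [j' j'j] := greedy_range he class_inj T G; rewrite fT /= => /(a_inj a_lt) E.
  by move: j'j ji; rewrite E; lia.
split.
  rewrite -(subnKC (ltnW xn)); apply: add_single_mpart => //.
  - by case/andP: (column_mpart x (a i)) => /forallP/(_ (a i)); rewrite ffunE eqxx.
  by rewrite sumn_nseq mul1n.
move=> y; rewrite (in_diagram_add (c := a i)) // => [|c' cc']; last first.
  by rewrite ffunE (negbTE cc').
split.
  case/orP => [|/shp[T Tn fT]]; last first.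
    exists (x + T)%N; first by lia.
    by rewrite ltnNge leq_addr /= addKn.
  rewrite in_column; case: y => [[r b] c] /= /andP[/andP[rx /eqP->] /eqP->].
  by exists r; rewrite ?rx //; apply: ltn_trans xn.
case=> T Tn; case: ltnP => Tx <-; first by rewrite in_column /= Tx !eqxx.
by apply/orP; right; apply/shp; exists (T - x)%N => //; lia.
Qed.

Lemma greedy_exists i : exists2 f, greedy i f &
  forall n, exists lambda, greedy_shape n f lambda.
Proof.
suff H m : forall i : 'I_t.+1, i = m :> nat -> exists2 f, greedy i f &
    forall n, exists lambda, greedy_shape n f lambda by apply: H erefl.
elim/ltn_ind: m => m IH {}i im; have [i0|i0] := posnP i.
  have -> : i = ord0 by apply: val_inj.
  exists (fun T => (T %% (e - 1), T %/ (e - 1), a ord0)%N); first exact: greedy_first.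
  move=> n; eexists; apply: (first_shape (divn_eq n (e - 1))).
  by have : (n %% (e - 1) < e - 1)%N; [rewrite ltn_mod | ]; lia.
have [j [x nx]] := next_exists he class_inj i0.
have [ji _ _ _] := nx.
have [f G shp] := IH j ltac:(lia) j erefl.
exists (fun T => if (T < x)%N then (T, 0%N, a i) else f (T - x)%N).
  exact: greedy_later nx G.
move=> n; have [nx'|xn] := leqP n x; first by eexists; apply: short_shape.
by have [lambda la] := shp (n - x)%N; eexists; apply: later_shape nx G xn la.
Qed.

End GreedyShapes.

(** * Dominance *)

Section TopSums.
Implicit Types (X : seq rat) (z x : rat).

Definition excess z x : rat := Num.max (x - z) 0.

Local Notation desc := (fun x y : rat => y <= x).

Lemma sorted_desc X : sorted desc (sort desc X).
Proof. by apply: (@sort_sorted _ desc) => x y; apply: le_total. Qed.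

Lemma nth_desc X i j : (i <= j < size X)%N ->
  nth 0 (sort desc X) j <= nth 0 (sort desc X) i.
Proof.
move=> /andP[ij jX]; apply: (sorted_leq_nth (leT := desc)) => //.
- by move=> x y z /= xy yz; apply: le_trans yz xy.
- exact: sorted_desc.
- by rewrite inE size_sort (leq_ltn_trans ij).
by rewrite inE size_sort.
Qed.

Lemma upper_nth_sort (P : pred rat) X i : (forall x y, x <= y -> P x -> P y) ->
  (i < size X)%N -> P (nth 0 (sort desc X) i) = (i < count P X)%N.
Proof.
move=> Pup iX; rewrite -(count_sort desc); set S := sort desc X.
have iS : (i < size S)%N by rewrite size_sort.
rewrite -[in RHS](cat_take_drop i S) count_cat; case Pi : (P (nth 0 S i)).
  have -> : count P (take i S) = i.
    rewrite -[RHS](size_takel (ltnW iS)); apply/eqP; rewrite -all_count.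
    apply/(all_nthP 0) => j; rewrite size_takel ?(ltnW iS) // => ji.
    by rewrite nth_take //; apply: Pup Pi; apply: nth_desc; rewrite ltnW.
  by rewrite (drop_nth 0 iS) /= Pi addnA addn1 ltnS leq_addr.
have -> : count P (drop i S) = 0%N.
  apply/eqP; rewrite -leqn0 leqNgt -has_count; apply/negP => /(has_nthP 0)[j].
  rewrite size_drop ltn_subRL nth_drop => ijS Pj.
  by move: Pi; rewrite (Pup _ _ _ Pj) //; apply: nth_desc; rewrite leq_addr -(size_sort desc).
by rewrite addn0 ltnNge (leq_trans (count_size _ _)) // size_take_min geq_minl.
Qed.

Lemma sum_excess_sort z X :
  \sum_(x <- X) excess z x = \sum_(i < size X) excess z (nth 0 (sort desc X) i).
Proof.
rewrite -(perm_big _ (permEl (perm_sort desc X))) /= (big_nth 0) size_sort.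
by rewrite big_mkord.
Qed.

(** The sum of the t largest entries is the minimum over z of this bound, attained when z separates
    them from the rest ([top_sum_eq]). Partial sums of [kappa] are thus compared without sorting. *)
Lemma top_sum_le X z t : (t <= size X)%N ->
  \sum_(i < t) nth 0 (sort desc X) i <= z *+ t + \sum_(x <- X) excess z x.
Proof.
move=> tX; rewrite sum_excess_sort.
have -> : z *+ t = \sum_(i < t) z by rewrite sumr_const card_ord.
rewrite -(big_mkord xpredT (fun i => excess z (nth 0 (sort desc X) i))).
rewrite (big_cat_nat (leq0n t) tX) //= big_mkord addrA -big_split /=.
rewrite -[X in X <= _]addr0; apply: lerD; last first.
  by apply: sumr_ge0 => i _; rewrite le_max lexx orbT.
by apply: ler_sum => i _; rewrite -lerBlDl le_max lexx.
Qed.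

Lemma top_sum_eq X z t : (t <= size X)%N ->
    (forall i, (i < t)%N -> z <= nth 0 (sort desc X) i) ->
    (forall i, (t <= i < size X)%N -> nth 0 (sort desc X) i <= z) ->
  \sum_(i < t) nth 0 (sort desc X) i = z *+ t + \sum_(x <- X) excess z x.
Proof.
move=> tX up low; rewrite sum_excess_sort.
have -> : z *+ t = \sum_(i < t) z by rewrite sumr_const card_ord.
rewrite -(big_mkord xpredT (fun i => excess z (nth 0 (sort desc X) i))).
rewrite (big_cat_nat (leq0n t) tX) //= big_mkord addrA -big_split /=.
rewrite [X in _ + X]big_nat_cond [X in _ + X]big1 ?addr0 => [|i]; last first.
  by rewrite andbT => /low il; apply/max_idPr; rewrite subr_le0.
apply: eq_bigr => i _; rewrite /excess (max_idPl _) ?subr_ge0 ?up //.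
by rewrite addrC subrK.
Qed.

(** The growth of the excess when a node of content x is added, raising a beta number from x - 1 to
    x. *)
Definition clamp z x : rat := excess z x - excess z (x - 1).

Lemma clamp_le z x y : x <= y -> clamp z x <= clamp z y.
Proof.
move=> xy; rewrite /clamp /excess.
by case: (leP (x - z) 0); case: (leP (y - z) 0); case: (leP (x - 1 - z) 0);
   case: (leP (y - 1 - z) 0) => *; lra.
Qed.

Lemma clamp_lt x y : x < y -> clamp (y - 1) x < clamp (y - 1) y.
Proof.
move=> xy; rewrite /clamp /excess.
by case: (leP (x - (y - 1)) 0); case: (leP (y - (y - 1)) 0);
   case: (leP (x - 1 - (y - 1)) 0); case: (leP (y - 1 - (y - 1)) 0) => *; lra.
Qed.

End TopSums.

(** * Beta numbers and the sequence [kappa] *)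

Section Kappa.
Variables (l : nat) (s : 'I_l -> int) (v : 'I_l -> rat).
Hypothesis l0 : (0 < l)%N.
Implicit Types mu lambda : mpart l.
Local Notation desc := (fun x y : rat => y <= x).
Local Notation content := (node_content s v).
Local Notation nonincr mu :=
  (forall c r r', (r <= r')%N -> (nth 0 (mu c) r' <= nth 0 (mu c) r)%N).

Definition beta mu (c : 'I_l) (x : nat) : rat :=
  (nth 0%N (mu c) x.-1)%:R - x%:R + charge s v c.

Definition beta_list mu N : seq rat := [seq beta mu c x | c <- enum 'I_l, x <- iota 1 N].

Lemma size_beta_list mu N : size (beta_list mu N) = (l * N)%N.
Proof. by rewrite size_allpairs size_iota -cardE card_ord. Qed.

Lemma leq_size_beta_list mu N : (N <= size (beta_list mu N))%N.
Proof. by rewrite size_beta_list leq_pmull. Qed.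

Lemma big_beta_list mu N (F : rat -> rat) :
  \sum_(x <- beta_list mu N) F x =
  \sum_(c < l) \sum_(r < N) F (beta mu c r.+1).
Proof.
rewrite big_allpairs_dep big_enum /=; apply: eq_bigr => c _.
by rewrite -[1%N]addn0 iotaDl big_map -(subn0 N) -/(index_iota 0 N) big_mkord subn0.
Qed.

Lemma count_beta_list mu N (P : pred rat) :
  count P (beta_list mu N) = (\sum_(c < l) \sum_(r < N) P (beta mu c r.+1))%N.
Proof.
rewrite -sum1_count big_mkcond big_allpairs_dep big_enum /=; apply: eq_bigr => c _.
rewrite -[1%N]addn0 iotaDl big_map -(subn0 N) -/(index_iota 0 N) big_mkord subn0.
by apply: eq_bigr => r _; rewrite add1n; case: (P _).
Qed.

Lemma beta_decr mu c x y : nonincr mu -> (0 < x <= y)%N -> beta mu c y <= beta mu c x.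
Proof.
move=> mu_le /andP[x0 xy]; rewrite /beta lerD2r.
apply: lerB; rewrite ler_nat // mu_le //; lia.
Qed.

Lemma count_beta_list_extend mu N N' (P : pred rat) :
    (N <= N')%N -> (forall c r, (N <= r < N')%N -> ~~ P (beta mu c r.+1)) ->
  count P (beta_list mu N') = count P (beta_list mu N).
Proof.
move=> NN' notP; rewrite !count_beta_list; apply: eq_bigr => c _.
rewrite -!(big_mkord xpredT (fun r => P (beta mu c r.+1) : nat)).
rewrite (big_cat_nat (leq0n N) NN') //= [X in (_ + X)%N]big_nat_cond.
rewrite [X in (_ + X)%N]big1 ?addn0 // => r; rewrite andbT => rN.
by rewrite (negbTE (notP c r rN)).
Qed.

(* An entry in a row beyond the (i+1)-st has i + 1 larger entries in its own  *)
(* component.                                                                 *)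
Lemma kappaE mu i N : nonincr mu -> (i < N)%N ->
  kappa s v mu i = nth 0 (sort desc (beta_list mu N)) i.
Proof.
move=> mu_le iN; rewrite -[LHS]/(nth 0 (sort desc (beta_list mu i.+1)) i).
suff H z : (z <= nth 0 (sort desc (beta_list mu i.+1)) i) =
    (z <= nth 0 (sort desc (beta_list mu N)) i).
  by apply: le_anti; rewrite -H lexx H lexx.
have up x y : x <= y -> z <= x -> z <= y by move=> xy zx; apply: le_trans xy.
rewrite !(upper_nth_sort up) ?(leq_trans _ (leq_size_beta_list _ _)) //.
have [|/existsPn noc] := boolP [exists c, z <= beta mu c i.+1]; last first.
  rewrite (@count_beta_list_extend mu i.+1 N) // => c r /andP[ir rN].
  by apply: contra (noc c) => zr; apply: le_trans zr (beta_decr _ mu_le _); rewrite /= ltnW.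
case/existsP => c zc.
have big M : (i < M)%N -> (i < count (fun x => z <= x)%R (beta_list mu M))%N.
  move=> iM; rewrite count_beta_list (bigD1 c) //= ltn_addr //.
  rewrite -(big_mkord xpredT (fun r => (z <= beta mu c r.+1)%R : nat)).
  rewrite (big_cat_nat (leq0n i.+1) iM) //= ltn_addr // (@eq_big_nat _ _ _ 0 i.+1 _ (fun=> 1%N)).
    by rewrite sum_nat_const_nat muln1 subn0.
  by move=> r /andP[_ ri]; rewrite (le_trans zc) // beta_decr.
by rewrite !big.
Qed.

Lemma kappa_sum mu t N : nonincr mu -> (t <= N)%N ->
  \sum_(i < t) kappa s v mu i = \sum_(i < t) nth 0 (sort desc (beta_list mu N)) i.
Proof.
by move=> mu_le tN; apply: eq_bigr => i _; apply: kappaE => //; apply: leq_trans tN.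
Qed.

Definition node_list mu N : seq (node l) :=
  [seq (rb.1, rb.2, c) | c <- enum 'I_l,
     rb <- [seq (r, b) | r <- iota 0 N, b <- iota 0 (nth 0 (mu c) r)]].

Lemma mem_node_list mu N x : (forall c, size (mu c) <= N)%N ->
  (x \in node_list mu N) = in_diagram mu x.
Proof.
move=> muN; case: x => [[r b] c]; apply/allpairsPdep/idP => /=.
  move=> [c' [[r' b'] [_ /allpairsPdep[r1 [b1 [_ b1lt [-> ->]]]] [-> -> ->]]]].
  by move: b1lt; rewrite mem_iota add0n.
move=> bx; exists c, (r, b); split=> //; first by rewrite mem_enum.
apply/allpairsPdep; exists r, b; split; rewrite ?mem_iota ?add0n //=.
rewrite ltnNge; apply/negP => Nr; move: bx; rewrite nth_default //.
exact: leq_trans Nr.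
Qed.

Lemma uniq_node_list mu N : uniq (node_list mu N).
Proof.
apply: allpairs_uniq_dep; first exact: enum_uniq.
  move=> c _; apply: allpairs_uniq_dep; rewrite ?iota_uniq //.
    by move=> r _; apply: iota_uniq.
  by move=> [r b] [r' b'] _ _ /= [-> ->].
by move=> [c [r b]] [c' [r' b']] _ _ /= [-> -> ->].
Qed.

Lemma big_node_list mu N (F : node l -> rat) :
  \sum_(x <- node_list mu N) F x =
  \sum_(c < l) \sum_(r < N) \sum_(b < nth 0%N (mu c) r) F (val r, val b, c).
Proof.
rewrite big_allpairs_dep big_enum /=; apply: eq_bigr => c _.
rewrite big_allpairs_dep /= -{1}(subn0 N) -/(index_iota 0 N) big_mkord.
apply: eq_bigr => r _; rewrite -{1}(subn0 (nth _ _ _)) -/(index_iota 0 _).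
by rewrite big_mkord.
Qed.

Lemma big_tableau mu n N (u : {ffun 'I_n -> node l}) (F : node l -> rat) :
    (forall c, size (mu c) <= N)%N -> standard_tableau mu u ->
  \sum_(k < n) F (u k) = \sum_(x <- node_list mu N) F x.
Proof.
move=> muN [uI uP _ _]; rewrite -(big_map u xpredT F); apply: perm_big.
apply: uniq_perm; first by rewrite map_inj_uniq ?index_enum_uniq.
  exact: uniq_node_list.
move=> x; rewrite mem_node_list //; apply/mapP/idP => [[k _ ->]|/uP[k <-]].
  by apply/uP; exists k.
by exists k; rewrite ?mem_index_enum.
Qed.

(** Each row is built from the empty one node by node, and the excess telescopes. *)
Lemma sum_excess_tableau mu n N (u : {ffun 'I_n -> node l}) z :
    (forall c, size (mu c) <= N)%N -> standard_tableau mu u ->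
  \sum_(x <- beta_list mu N) excess z x =
  \sum_(x <- beta_list (mpart0 l) N) excess z x + \sum_(k < n) clamp z (content (u k)).
Proof.
move=> muN su; rewrite (big_tableau (fun x => clamp z (content x)) muN su).
rewrite big_node_list !big_beta_list -big_split; apply: eq_bigr => c _ /=.
rewrite -big_split; apply: eq_bigr => r _ /=; apply/eqP; rewrite addrC -subr_eq; apply/eqP.
pose g b := excess z (b%:R - r.+1%:R + charge s v c).
rewrite {1}/beta [X in _ - X](_ : _ = g 0%N); last by rewrite /beta ffunE nth_nil.
rewrite -/(g _) -(telescope_sumr g) // big_mkord; apply: eq_bigr => b _.
rewrite /clamp /g /node_content /charge /=; congr (excess _ _ - excess _ _).
  by rewrite !rmorphB rmorphD /= -!pmulrn !(=^~ natr1); ring.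
by rewrite !rmorphB rmorphD /= -!pmulrn !(=^~ natr1); ring.
Qed.

Lemma contents_dominance mu lambda n (u w : {ffun 'I_n -> node l}) :
    nonincr mu -> nonincr lambda ->
    standard_tableau mu u -> standard_tableau lambda w ->
    (forall k, content (u k) <= content (w k)) ->
    (exists k, content (u k) < content (w k)) ->
  ll_order s v mu lambda.
Proof.
move=> mu_le la_le su sw uw [k0 uw0]; right.
pose N0 := \max_(c < l) maxn (size (mu c)) (size (lambda c)).
have N0P c : (size (mu c) <= N0)%N && (size (lambda c) <= N0)%N.
  by rewrite -geq_max; apply: (leq_bigmax c).
have muN N : (N0 <= N)%N -> forall c, (size (mu c) <= N)%N.
  by move=> NN c; apply: leq_trans NN; case/andP: (N0P c).
have laN N : (N0 <= N)%N -> forall c, (size (lambda c) <= N)%N.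
  by move=> NN c; apply: leq_trans NN; case/andP: (N0P c).
split; last first.
  case=> [|t]; first by rewrite !big_ord0.
  pose N := maxn N0 t.+1; have NN : (N0 <= N)%N by apply: leq_maxl.
  have tN : (t < N)%N by apply: leq_maxr.
  have tX nu : (t < size (beta_list nu N))%N by apply: leq_trans (leq_size_beta_list _ _).
  (* z is the least of the t + 1 largest numbers of lambda, so the bound is attained for lambda. *)
  rewrite !(kappa_sum _ tN) //; set z := nth 0 (sort desc (beta_list lambda N)) t.
  rewrite [leRHS](@top_sum_eq _ z) //; last 2 first.
  - by move=> i it; apply: nth_desc; rewrite -ltnS it tX.
  - by move=> i /andP[ti iX]; apply: nth_desc; rewrite ltnW.
  apply: le_trans (top_sum_le z (tX _)) _; rewrite lerD2l.
  rewrite (sum_excess_tableau z (muN N NN) su) (sum_excess_tableau z (laN N NN) sw).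
  by rewrite lerD2l; apply: ler_sum => k _; apply: clamp_le.
(* At this z [clamp] separates the contents at k0 strictly. With t the number of entries of lambda
   above z, the bound is attained for lambda, so the t-th partial sums differ; N1 is such that rows
   of lambda beyond [N2] contribute no entry above z. *)
move=> same; pose z := content (w k0) - 1.
pose N1 := \max_(c < l) Num.bound `|charge s v c - z|%R.
pose N2 := maxn N0 N1; pose P x := z < x.
have Pup x y : x <= y -> P x -> P y by move=> xy zx; apply: lt_le_trans xy.
pose t := count P (beta_list lambda N2); pose N := maxn N2 t.
have NN2 : (N2 <= N)%N by apply: leq_maxl.
have NN : (N0 <= N)%N by apply: leq_trans (leq_maxl _ _) NN2.
have tN : (t <= N)%N by apply: leq_maxr.
have tX nu : (t <= size (beta_list nu N))%N by apply: leq_trans (leq_size_beta_list _ _).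
have tE : count P (beta_list lambda N) = t.
  apply: count_beta_list_extend => // c r /andP[N2r rN]; rewrite /P -leNgt /beta.
  rewrite nth_default /=; last by apply: leq_trans (laN N2 (leq_maxl _ _) c) N2r.
  have : (Num.bound `|charge s v c - z|%R <= r)%N.
    by apply: leq_trans N2r; apply: leq_trans (leq_maxr _ _); apply: (leq_bigmax c).
  rewrite -(ler_nat rat) => /(lt_le_trans (archi_boundP (normr_ge0 _))).
  move/(le_lt_trans (ler_norm _)); rewrite -[r.+1]addn1 natrD.
  by move: r%:R => R; lra.
have := top_sum_le z (tX mu); rewrite -kappa_sum //.
rewrite (eq_bigr _ (fun (i : 'I_t) _ => same i)) (kappa_sum la_le tN).
rewrite (@top_sum_eq _ z) //; last 2 first.
- by move=> i it; apply: ltW; rewrite -/(P _) (upper_nth_sort Pup) ?tE // (leq_trans it).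
- by move=> i /andP[ti iX]; rewrite leNgt -/(P _) (upper_nth_sort Pup) // tE -leqNgt.
rewrite (sum_excess_tableau z (muN N NN) su) (sum_excess_tableau z (laN N NN) sw).
rewrite !lerD2l leNgt => /negP[]; rewrite (bigD1 k0) // [ltRHS](bigD1 k0) //=.
apply: ltr_leD; first exact: clamp_lt.
by apply: ler_sum => k _; apply: clamp_le.
Qed.

End Kappa.

(** * Labels *)

Lemma prim_expz_eq (F : fieldType) (e : nat) (eta : F) (x y : int) :
  e.-primitive_root eta -> eta ^ x = eta ^ y <-> (e%:Z %| x - y)%Z.
Proof.
move=> prim; have eta0 : eta != 0 by rewrite (prim_root_eq0 prim) -lt0n (prim_order_gt0 prim).
have key z : (eta ^ z == 1) = (e%:Z %| z)%Z.
  case: z => m; first by rewrite -exprnP -(prim_order_dvd prim).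
  by rewrite NegzE -exprnN invr_eq1 -(prim_order_dvd prim) rpredN.
rewrite -key expfzDr // -invr_expz; split=> [->|/eqP E].
  by rewrite mulfV ?expfz_neq0.
by apply: (mulIf (invr_neq0 (expfz_neq0 y eta0))); rewrite E mulfV ?expfz_neq0.
Qed.

Lemma ll_order_anti l (s : 'I_l -> int) (v : 'I_l -> rat) (mu lambda : mpart l) :
  ll_order s v mu lambda -> ll_order s v lambda mu -> mu = lambda.
Proof.
move=> [//|[neq le1]] [//|[_ le2]]; case: neq => i.
have E t : \sum_(i < t) kappa s v mu i = \sum_(i < t) kappa s v lambda i.
  by apply: le_anti; rewrite le1 le2.
by have := E i.+1; rewrite !big_ord_recr /= E => /addrI.
Qed.

Section GreedyLabel.
Variables (F : fieldType) (l e : nat) (s : 'I_l -> int) (eta : F).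
Hypothesis he : (2 <= e)%N.
Hypothesis prim_eta : e.-primitive_root eta.
Variable theta : {rmorphism laurent l F -> F}.
Hypothesis theta_spec : is_specialization eta s theta.
Variable V : forall m, mpart l -> AKmodule (laurent_q l F) (@laurent_Q l F) m.
Hypothesis formV : forall m (lambda : mpart l),
  is_mpart m lambda -> is_form lambda (V m lambda).
Variable v : 'I_l -> rat.
Hypothesis v_lt : forall c c' : 'I_l, (c < c')%N -> v c < v c'.
Hypothesis v_bound : forall c c' : 'I_l, v c' < v c + e%:R.
Variables (t : nat) (a : 'I_t.+1 -> 'I_l).
Local Notation sa j := (s (a j)).
Hypothesis max_class : forall c j, (e%:Z %| s c - sa j)%Z -> s c <= sa j.
Hypothesis min_index : forall c j, (e%:Z %| s c - sa j)%Z -> (c < a j)%N -> s c < sa j.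
Hypothesis class_cover : forall c, exists j, (e%:Z %| s c - sa j)%Z.
Hypothesis a_lt : forall i j : 'I_t.+1, (i < j)%N -> (a i < a j)%N.
Hypothesis sa_gt : forall i j : 'I_t.+1, (i < j)%N -> sa j < sa i.
Hypothesis class_inj : forall i j, (e%:Z %| sa i - sa j)%Z -> i = j.

Lemma greedy_label i f n lambda : (0 < n)%N ->
    greedy e s a i f -> greedy_shape n f lambda ->
  theta_label s v theta V n (single (nseq n 1%N) (a i)) = lambda.
Proof.
move=> n0 G shp.
have eta0 : eta != 0.
  by rewrite (prim_root_eq0 prim_eta) -lt0n (prim_order_gt0 prim_eta).
have eta1 : eta != 1.
  apply/eqP => E; have := prim_order_dvd prim_eta 1; rewrite E expr1n eqxx dvdn1.
  by move/eqP; lia.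
have weightE (x : node l) (k : nat) : eta ^ node_weight s x = sign_weight eta s (a i) k <->
    (e%:Z %| node_weight s x - (sa i - k%:Z))%Z by apply: prim_expz_eq.
set M := V n (single (nseq n 1%N) (a i)).
have formM : is_form (single (nseq n 1%N) (a i)) M.
  exact: formV (column_mpart _ _).
have [la _] := shp; have st0 := greedy_standard he a_lt class_inj G shp.
have mpart_nonincr (mu : mpart l) : is_mpart n mu ->
    forall c r r', (r <= r')%N -> (nth 0 (mu c) r' <= nth 0 (mu c) r)%N.
  by case/andP => /forallP muP _ c r r'; apply: part_nonincr.
have lab : is_label s v (fun mu => base_change theta (V n mu)) (base_change theta M) lambda.
  split=> //.
    apply: (sign_comp_mult_eq1 theta_spec eta0 eta1 n0 formM (formV la) st0).
    - by move=> k; apply/weightE; rewrite ffunE; apply: greedy_weight.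
    - move=> u su uc; apply: (greedy_tableau_uniq he a_lt class_inj G shp su) => k.
      exact/weightE.
    move=> u m m' su m'm uc um; have /negP[] := greedy_no_repeat he a_lt class_inj G shp su m'm
      (fun k km => (weightE _ _).1 (uc k km)).
    exact/weightE.
  move=> mu muP /(sign_comp_mult_neq0 theta_spec eta0 eta1 n0 formM (formV muP))[u [su uc]].
  have uw (k : 'I_n) : (e%:Z %| node_weight s (u k) - (sa i - (k : nat)%:Z))%Z.
    exact/weightE.
  have mu_part c : is_part (mu c) by case/andP: muP => /forallP.
  have dom m := dominated he max_class min_index class_cover a_lt sa_gt class_inj
    v_lt v_bound mu_part su G uw m.
  (* If all components and weights agree, u is the greedy tableau and mu = lambda; otherwise some
     content is strictly smaller. *)
  have [same|/existsNP[k0 neq]] := pselect (forall m : 'I_n,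
      (u m).2 = (f m).2 /\ node_weight s (u m) = node_weight s (f m)).
    left; apply: (mpart_eq muP la) => x.
    have uE := dominated_eq he a_lt class_inj mu_part su G same.
    have [_ uP _ _] := su; have [_ tP _ _] := st0.
    by rewrite uP tP uE.
  apply: (contents_dominance _ (mpart_nonincr _ muP) (mpart_nonincr _ la) su st0).
  - exact: leq_ltn_trans (ltn_ord (a i)).
  - by move=> k; rewrite ffunE; case: (dom k).
  exists k0; rewrite ffunE lt_neqAle; have [le eq] := dom k0; rewrite le andbT.
  by apply/eqP => /eq.
apply: xget_unique => [|lambda' lab']; first exact: lab.
have [_ l1 l2] := lab; have [l3 l4 l5] := lab'.
apply: (ll_order_anti (s := s) (v := v)); first by apply: l2; rewrite // l4.
by apply: l5 => //; rewrite l1.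
Qed.

End GreedyLabel.

Theorem proposition6p5 (R : realType) (l n e : nat)
  (hl : (1 <= l)%N) (hn : (1 <= n)%N) (he : (2 <= e)%N)
  (s : 'I_l -> int)
  (eta : R[i]) (heta : e.-primitive_root eta)
  (theta : {rmorphism laurent l R[i] -> R[i]})
  (htheta : is_specialization eta s theta)
  (V : forall m, mpart l ->
         AKmodule (laurent_q l R[i]) (@laurent_Q l R[i]) m)
  (hV : forall m (lambda : mpart l),
          is_mpart m lambda -> is_form lambda (V m lambda))
  (v : 'I_l -> rat)
  (hv : forall i j : 'I_l, (i < j)%N -> v i < v j)
  (hve : forall i j : 'I_l, v j < v i + e%:R)
  (t : nat) (k : 'I_t.+1 -> 'I_e) (a : 'I_t.+1 -> 'I_l)
  (hk : injective k)
  (hkI : [set k i | i : 'I_t.+1] = residue_set e s)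
  (ha : forall i, is_alpha s (k i) (a i))
  (ha_lt : forall i j : 'I_t.+1, (i < j)%N -> (a i < a j)%N)
  (hs : forall i j : 'I_t.+1, (i < j)%N -> s (a j) < s (a i)) :
  (forall q r : nat, n = (q * (e - 1) + r)%N -> (r <= e - 2)%N ->
     theta_label s v theta V n (single (nseq n 1%N) (a ord0)) =
     single [seq p <- nseq r q.+1 ++ nseq (e - 1 - r) q | (0 < p)%N] (a ord0))
  /\
  (forall (i j : 'I_t.+1) (x : nat),
     (0 < i)%N -> (j < i)%N ->
     (1 <= x <= e - 1)%N ->
     (x%:Z = (k i)%:Z - (k j)%:Z %[mod e%:Z])%Z ->
     (forall (j' : 'I_t.+1) (x' : nat), (j' < i)%N -> (1 <= x' <= e - 1)%N ->
        (x'%:Z = (k i)%:Z - (k j')%:Z %[mod e%:Z])%Z -> (x <= x')%N) ->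
     theta_label s v theta V n (single (nseq n 1%N) (a i)) =
     (if (n <= x)%N then single (nseq n 1%N) (a i)
      else add_mpart (single (nseq x 1%N) (a i))
             (theta_label s v theta V (n - x)
                (single (nseq (n - x) 1%N) (a j))))).
Proof.
(* The residues k_i are replaced by the congruent charges s (a i) throughout. *)
have dvd_k i : (e%:Z %| s (a i) - (k i : nat)%:Z)%Z.
  by have /andP[/andP[]] := ha i; rewrite /residue_class eqz_mod_dvd.
have class_k c j : (e%:Z %| s c - s (a j))%Z -> residue_class s (k j) c.
  by rewrite /residue_class eqz_mod_dvd => H; apply: (dvdz_sum H (dvd_k j)); ring.
have max_class c j : (e%:Z %| s c - s (a j))%Z -> s c <= s (a j).
  by move/class_k => cj; have /andP[/andP[_ /forallP/(_ c)/implyP->]] := ha j.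
have min_index c j : (e%:Z %| s c - s (a j))%Z -> (c < a j)%N -> s c < s (a j).
  move=> cj caj; rewrite lt_neqAle max_class // andbT; apply/eqP => E.
  have /andP[/andP[_ amax] /forallP/(_ c)/implyP] := ha j.
  rewrite leqNgt caj => H; suff: is_max_in_class s (k j) c by move/H.
  by rewrite /is_max_in_class class_k //= E.
have class_cover c : exists j, (e%:Z %| s c - s (a j))%Z.
  have e0 : (0 < e)%N by lia.
  have mlt : (`|(s c %% e%:Z)%Z| < e)%N.
    by rewrite -ltz_nat gez0_abs ?modz_ge0 ?ltz_pmod //; lia.
  have : Ordinal mlt \in residue_set e s.
    rewrite inE; apply/existsP; exists c; rewrite /residue_class /= gez0_abs ?modz_ge0 //; last lia.
    by rewrite modz_mod.
  rewrite -hkI => /imsetP[j _ jE]; exists j.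
  have := dvd_k j; rewrite -jE /= gez0_abs ?modz_ge0 //; last by lia.
  move=> H; have : (e%:Z %| s c - (s c %% e%:Z)%Z)%Z.
    by rewrite {1}(divz_eq (s c) e%:Z) addrK dvdz_mull.
  by move=> H2; apply: (dvdz_diff H2 H); ring.
have class_inj i j : (e%:Z %| s (a i) - s (a j))%Z -> i = j.
  move=> ij; apply: hk; apply: val_inj => /=.
  have H : (e%:Z %| (k i : nat)%:Z - (k j : nat)%:Z)%Z.
    by apply: (dvdz_sum (dvdz_diff ij (dvd_k i) erefl) (dvd_k j)); ring.
  have := ltn_ord (k i); have := ltn_ord (k j).
  case: (ltngtP (k i) (k j)) => // lt kje kie.
    have : (e%:Z %| (k j : nat)%:Z - (k i : nat)%:Z)%Z by rewrite -opprB rpredN.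
    by move/dvdz_pos_ge; lia.
  by move/dvdz_pos_ge: H; lia.
have label_of := greedy_label he heta htheta hV hv hve max_class min_index class_cover
  ha_lt hs class_inj.
split=> [q r nE re|i j x i0 ji xe xE xmin].
  by apply: label_of hn (greedy_first _ _ _) (first_shape a he nE re).
have hit (j' : 'I_t.+1) (x' : nat) :
    (x'%:Z == (k i)%:Z - (k j')%:Z %[mod e%:Z])%Z = (e%:Z %| s (a i) - s (a j') - x'%:Z)%Z.
  rewrite eqz_mod_dvd; apply/idP/idP => H.
    by apply: (dvdz_diff (dvdz_diff (dvd_k i) (dvd_k j') erefl) H); ring.
  by apply: (dvdz_diff (dvdz_diff (dvd_k i) (dvd_k j') erefl) H); ring.
have nx : is_next e s a i j x.
  split=> //; first by rewrite -hit; apply/eqP.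
  by move=> j' x' j'i x'e; rewrite -hit => /eqP; apply: xmin.
(* Prolonging the procedure for j by x steps gives one for i; its shape after n - x steps is the
   label in the recursion. *)
have [f G shp] := greedy_exists he ha_lt class_inj j.
have Gi := greedy_later nx G; have [nx'|xn] := leqP n x.
  by apply: label_of hn Gi (short_shape _ _ _ nx').
have [lambda la] := shp (n - x)%N.
rewrite (label_of _ _ _ _ _ G la) ?subn_gt0 //.
exact: label_of hn Gi (later_shape he ha_lt class_inj nx G xn la).
Qed.
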